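(* Let $p>1$, $a\in\mathbb{R}$ with $a\le 1$, and $R\ge 1$. Let $(f,g)\in C_0^2(\mathbb{R})\times C_0^1(\mathbb{R})$ satisfy $\operatorname{supp} f,\ \operatorname{supp} g\subset\{x\in\mathbb{R}:|x|\le R\}$. Assume that $$\int_{\mathbb{R}}(-e^x+e^{-x})f'(x)\,dx\ge 0\qquad\text{and}\qquad \int_{\mathbb{R}}(-e^x+e^{-x})\{g'(x)-f'(x)\}\,dx> 0.$$ Then there exist a constant $\varepsilon_1=\varepsilon_1(f,g,p,a,R)>0$ and a constant $C>0$ independent of $\varepsilon$ such that, for every $\varepsilon\in(0,\varepsilon_1]$, the classical solution of the Cauchy problem $$u_{tt}-u_{xx}=\frac{|u_x|^p}{\langle x\rangle^a}\ \text{ in }\mathbb{R}\times(0,T),\qquad u(x,0)=\varepsilon f(x),\quad u_t(x,0)=\varepsilon g(x),\quad x\in\mathbb{R},$$ cannot exist on the time interval $[0,T)$ whenever $$T>\begin{cases} C\varepsilon^{-(p-1)/(1-a)} & \text{if } a<1,\\ \exp\left(C\varepsilon^{-(p-1)}\right) & \text{if } a=1.\end{cases}$$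
   Context: Notation: $\langle x\rangle=(1+x^2)^{1/2}$ for $x\in\mathbb{R}$. $C_0^k(\mathbb{R})$ denotes the $C^k$ functions with compact support. A classical solution on the time interval $[0,T)$ is a real-valued function $u=u(x,t)\in C^2(\mathbb{R}\times[0,T))$ satisfying the equation and the initial conditions pointwise. *)

(* Defs.v *)
From Stdlib Require Import Reals.
From Coquelicot Require Import Coquelicot.
Open Scope R_scope.

(* [Rpower 0 p] evaluates to 1 in the standard library (because [ln 0 = 0]),
   so the value 0 at 0, which is the right one for [p > 0], is set by hand. *)
Definition abs_pow (y p : R) : R :=
  if Req_EM_T y 0 then 0 else Rpower (Rabs y) p.

Definition japanese (x : R) : R := sqrt (1 + x ^ 2).

Definition supp (f : R -> R) : R -> Prop := adherence (fun x => f x <> 0).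

Definition Ck (k : nat) (f : R -> R) : Prop :=
  forall n x, (n <= k)%nat -> ex_derive_n f n x /\ continuous (Derive_n f n) x.

Definition Ck0 (k : nat) (f : R -> R) : Prop := Ck k f /\ compact (supp f).

Definition integral_R (h : R -> R) : R :=
  RInt_gen h (Rbar_locally m_infty) (Rbar_locally p_infty).

(* Functions on [R x [0,T)] are represented by [u : R -> R -> R] (space variable
   first); their values at times outside [[0,T)] are irrelevant. *)
Definition time_interval (T t : R) : Prop := 0 <= t < T.

Definition strip (T : R) (z : R * R) : Prop := time_interval T (snd z).

Definition is_dx (T : R) (u v : R -> R -> R) : Prop :=
  forall x t, time_interval T t -> is_derive (fun y => u y t) x (v x t).

(* The derivative is taken within [[0,T)], hence one-sided at [t = 0]. *)
Definition is_dt (T : R) (u v : R -> R -> R) : Prop :=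
  forall x t, time_interval T t -> D_in (u x) (v x) (time_interval T) t.

Fixpoint Ck_strip (k : nat) (T : R) (u : R -> R -> R) : Prop :=
  continuous_on (strip T) (fun z : R * R => u (fst z) (snd z)) /\
  match k with
  | O => True
  | S k' => exists ux ut : R -> R -> R,
      is_dx T u ux /\ is_dt T u ut /\ Ck_strip k' T ux /\ Ck_strip k' T ut
  end.

Definition classical_solution
  (p a : R) (u0 u1 : R -> R) (T : R) (u : R -> R -> R) : Prop :=
  Ck_strip 2 T u /\
  exists ux uxx ut utt : R -> R -> R,
    is_dx T u ux /\ is_dx T ux uxx /\ is_dt T u ut /\ is_dt T ut utt /\
    (forall x t, 0 < t < T ->
       utt x t - uxx x t = abs_pow (ux x t) p / Rpower (japanese x) a) /\
    (forall x, u x 0 = u0 x) /\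
    (forall x, ut x 0 = u1 x).

(* Used only for [a <= 1], so that the second branch is the case [a = 1]. *)
Definition lifespan_bound (p a C eps : R) : R :=
  if Rlt_dec a 1 then C * Rpower eps (- (p - 1) / (1 - a))
  else exp (C * Rpower eps (- (p - 1))).

(* Main.v *)
Require Import Defs.
From Stdlib Require Import Reals Lra.
From Coquelicot Require Import Coquelicot.
Open Scope R_scope.

(** The proof follows one weighted average of the solution until it is forced
    to be infinite.  Put [F t = int u(x,t) (e^x + e^-x) dx].  The weight
    [cosh2 x = e^x + e^-x] equals its own second derivative, so integrating by
    parts twice gives [F'' - F = int |u_x|^p <x>^-a cosh2 dx >= 0].  The two
    hypotheses on the data, integrated by parts once, say that [F 0 >= 0] and
    [F' 0 - F 0 > 0], both proportional to [eps].

    All boundary terms vanish, and the integrals live on [|x| <= t + r], because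
    of finite propagation speed ([finite_speed]).  This is derived from the
    equation itself: the Riemann invariants [u_t + u_x] and [u_t - u_x] are
    transported along characteristics with the source [|u_x|^p <x>^-a], which is
    Lipschitz in [u_x] on bounded sets since [p > 1], so a Gronwall iteration in
    a backward light cone with vanishing base forces both to vanish.

    The same integration by parts gives [F = - int u_x sinh2] and therefore
    [|F| <= int |u_x| cosh2].  Hölder's inequality on [|x| <= t + r], where the
    weight has mass of order [e^t] up to a power of [t] ([holder_cosh]), bounds the source from below by
    [c |F|^p e^(-(p-1)t) (t+B)^-a].  With [H = e^-t F] and [K = H'] this reads
    [K' + 2 K >= c H^p (t+B)^-a], with data of size [eps] ([moment_source_lower],
    [moments_satisfy_ode]).

    For this differential inequality ([ode_blow_up]) write [h = H / eps],
    [k = K / eps] and [mu = eps^(p-1)].  While [h] is moderate, [2 k] balances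
    the source, but for large [h] one cannot expect [k] to be as large as [h^p].
    A smaller power suffices: with [q = (p+1)/2 > 1] the barrier
    [k >= delta mu (h+1)^q (t+B)^-a] propagates ([ode_barrier]).  It makes
    [(h+1)^(1-q)], which is positive and at most [1], decrease at rate at least
    [(q-1) delta mu (t+B)^-a], so [mu int_0^T (t+B)^-a dt] stays bounded, which is
    the claimed bound on the lifespan.

    Time derivatives are one-sided at [t = 0], while the calculus of parametric
    integrals and of functions of two variables is two-sided; functions on the
    strip are therefore composed with [t |-> |t|] wherever continuity at the
    initial time is at stake. *)

(** * Monotonicity and real powers *)

Lemma derive_nonneg_le (F dF : R -> R) (a b : R) :
  a <= b ->
  (forall x, a < x < b -> is_derive F x (dF x)) ->
  (forall x, a <= x <= b -> continuity_pt F x) ->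
  (forall x, a < x < b -> 0 <= dF x) ->
  F a <= F b.
Proof.
  intros Hab HD HC HP.
  (* [MVT_gen] may return an endpoint, where nothing is known of [dF]. *)
  set (d := fun x => if Rlt_dec a x then if Rlt_dec x b then dF x else 0 else 0).
  destruct (MVT_gen F a b d) as [c [_ Hc]].
  - rewrite Rmin_left, Rmax_right by lra. intros x Hx. unfold d.
    destruct (Rlt_dec a x); [|lra]. destruct (Rlt_dec x b); [|lra].
    now apply HD.
  - rewrite Rmin_left, Rmax_right by lra. exact HC.
  - assert (0 <= d c).
    { unfold d. destruct (Rlt_dec a c); [|lra]. destruct (Rlt_dec c b); [|lra].
      now apply HP. }
    nra.
Qed.

(** Only the sign of the derivative where [D <= 0] matters: if [D] became
    negative, it would be nondecreasing since the last time at which [D >= 0]. *)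
Lemma barrier (D dD : R -> R) (b : R) :
  (forall t, 0 < t < b -> is_derive D t (dD t)) ->
  (forall t, 0 <= t <= b -> continuity_pt D t) ->
  0 <= D 0 ->
  (forall t, 0 < t < b -> D t <= 0 -> 0 <= dD t) ->
  forall t, 0 <= t <= b -> 0 <= D t.
Proof.
  intros HD HC H0 HB t Ht.
  destruct (Rle_lt_dec 0 (D t)) as [|Hneg]; [assumption|exfalso].
  set (E := fun s => 0 <= s <= t /\ 0 <= D s).
  destruct (completeness E) as [s [Hub Hlub]].
  { exists t. intros x [Hx _]; lra. }
  { exists 0. split; [lra|assumption]. }
  assert (Hs0 : 0 <= s) by (apply Hub; split; [lra|assumption]).
  assert (Hst : s <= t) by (apply Hlub; intros x [Hx _]; lra).
  assert (HDs : 0 <= D s).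
  { destruct (Rle_lt_dec 0 (D s)) as [|Hn]; [assumption|exfalso].
    destruct (HC s ltac:(lra) (- D s) ltac:(lra)) as [d [Hd Hc]].
    assert (s <= s - d); [|lra].
    apply Hlub. intros x [Hx HDx].
    destruct (Rle_lt_dec x (s - d)) as [|Hx']; [assumption|exfalso].
    assert (x <= s) by (apply Hub; split; assumption).
    destruct (Req_dec x s) as [->|Hne]; [lra|].
    assert (Hd' : Rabs (D x - D s) < - D s).
    { apply (Hc x). split.
      - split; [exact I|congruence].
      - simpl. unfold Rdist. rewrite Rabs_left1; lra. }
    apply Rabs_lt_between in Hd'. lra. }
  assert (D s <= D t); [|lra].
  apply (derive_nonneg_le D dD); try assumption.
  - intros x Hx. apply HD. lra.
  - intros x Hx. apply HC. lra.
  - intros x Hx. apply HB; [lra|].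
    destruct (Rle_lt_dec (D x) 0); [assumption|].
    assert (x <= s); [|lra]. apply Hub. split; lra.
Qed.

Lemma Rpower_pos (x y : R) : 0 < Rpower x y.
Proof. apply exp_pos. Qed.

Lemma is_derive_Rpower (s x : R) :
  0 < x -> is_derive (fun y => Rpower y s) x (s * Rpower x (s - 1)).
Proof. intros Hx. apply is_derive_Reals. now apply derivable_pt_lim_power. Qed.

Lemma Rpower_base_le1 (x y : R) : 1 <= x -> 0 <= y -> 1 <= Rpower x y.
Proof.
  intros Hx Hy. rewrite <- (Rpower_O x) by lra. apply Rle_Rpower; lra.
Qed.

Lemma is_derive_continuity_pt (F : R -> R) (x l : R) :
  is_derive F x l -> continuity_pt F x.
Proof.
  intros H. apply derivable_continuous_pt. exists l. now apply is_derive_Reals.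
Qed.

Lemma is_derive_Rpower_comp (F : R -> R) (s x l : R) :
  0 < F x -> is_derive F x l ->
  is_derive (fun y => Rpower (F y) s) x (l * (s * Rpower (F x) (s - 1))).
Proof.
  intros Hp HF.
  apply (is_derive_comp (fun y => Rpower y s) F); [|exact HF].
  now apply is_derive_Rpower.
Qed.

Lemma continuity_pt_Rpower_comp (F : R -> R) (s x : R) :
  0 < F x -> continuity_pt F x -> continuity_pt (fun y => Rpower (F y) s) x.
Proof.
  intros Hp HF.
  apply (continuity_pt_comp F (fun y => Rpower y s)); [exact HF|].
  eapply is_derive_continuity_pt. now apply is_derive_Rpower.
Qed.

(** * Blow-up for the differential inequality *)

(** The constants are tied together for [ode_barrier]: [m] is a lower bound for
    [k] up to time [1] and hence for [h] after it; [kappa] compares [h] with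
    [h + 1] once [h >= m]; [hd1] lets the source beat the growth of the barrier
    when [h >= m], [hd2] keeps the barrier below [m] when [h < m], and [hd3]
    handles the initial time.  [hw] is what confines the argument to times up to
    [T0] when [a < 0], as [w] then grows. *)
Section Ode.
Variables p a B c c0 c1 delta mu T0 : R.
Variables h k k1 : R -> R.
Let q := (p + 1) / 2.
Let m := c0 * exp (-2).
Let kappa := m / (1 + m).
Let w := fun t => Rpower (t + B) (- a).
Hypotheses (hp : 1 < p) (hB : 1 <= B) (hc : 0 < c) (hc0 : 0 < c0) (hc1 : 0 <= c1).
Hypotheses (hd : 0 < delta <= 1) (hd1 : delta * (2 + Rabs a + q) <= c * Rpower kappa p)
 (hd2 : 2 * (delta * Rpower (m + 1) q) <= m) (hd3 : delta * Rpower (c1 + 1) q <= c0).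
Hypotheses (hmu : 0 < mu) (hT0 : 0 <= T0) (hw : forall t, 0 <= t <= T0 -> mu * w t <= 1).
Hypotheses (Ch : forall t, 0 <= t <= T0 -> continuity_pt h t)
 (Ck : forall t, 0 <= t <= T0 -> continuity_pt k t)
 (Dh : forall t, 0 < t < T0 -> is_derive h t (k t))
 (Dk : forall t, 0 < t < T0 -> is_derive k t (k1 t))
 (h0 : h 0 = c1) (k0 : k 0 = c0)
 (hk0 : forall t, 0 < t < T0 -> 0 <= k1 t + 2 * k t)
 (hk : forall t, 0 < t < T0 -> 0 < h t -> c * mu * Rpower (h t) p * w t <= k1 t + 2 * k t).

Lemma ode_k_lower (t : R) : 0 <= t <= T0 -> c0 * exp (- 2 * t) <= k t.
Proof.
  intros Ht.
  assert (Hm : k 0 * exp (2 * 0) <= k t * exp (2 * t)).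
  { apply (derive_nonneg_le (fun s => k s * exp (2 * s))
             (fun s => (k1 s + 2 * k s) * exp (2 * s))); [lra| | |].
    - intros s Hs. assert (Hks := Dk s ltac:(lra)).
      evar_last.
      + apply (is_derive_mult k (fun s => exp (2 * s))).
        * exact Hks.
        * auto_derive; [exact I|reflexivity].
        * intros; apply Rmult_comm.
      + unfold plus, mult; simpl. ring.
    - intros s Hs. apply (continuity_pt_mult k (fun s => exp (2 * s))).
      + apply Ck. lra.
      + apply is_derive_continuity_pt with (2 * exp (2 * s)).
        auto_derive; [exact I|ring].
    - intros s Hs. apply Rmult_le_pos; [apply hk0; lra|apply Rlt_le, exp_pos]. }
  rewrite Rmult_0_r, exp_0, k0, Rmult_1_r in Hm.
  apply Rmult_le_reg_r with (exp (2 * t)); [apply exp_pos|].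
  rewrite Rmult_assoc, <- exp_plus.
  replace (-2 * t + 2 * t) with 0 by ring. rewrite exp_0. lra.
Qed.

Lemma ode_k_pos (t : R) : 0 <= t <= T0 -> 0 < k t.
Proof.
  intros Ht. apply Rlt_le_trans with (2 := ode_k_lower t Ht).
  apply Rmult_lt_0_compat; [lra|apply exp_pos].
Qed.

Lemma ode_k_early (t : R) : 0 <= t <= T0 -> t <= 1 -> m <= k t.
Proof.
  intros Ht H1. apply Rle_trans with (2 := ode_k_lower t Ht).
  apply Rmult_le_compat_l; [lra|].
  destruct (Req_dec t 1) as [->|]; [apply Req_le; f_equal; ring|].
  apply Rlt_le, exp_increasing. lra.
Qed.

Lemma ode_h_mono (s t : R) : 0 <= s <= t -> t <= T0 -> h s <= h t.
Proof.
  intros Hs Ht. apply (derive_nonneg_le h k); [lra| | |].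
  - intros; apply Dh; lra.
  - intros; apply Ch; lra.
  - intros; apply Rlt_le, ode_k_pos; lra.
Qed.

Lemma ode_h_nonneg (t : R) : 0 <= t <= T0 -> 0 <= h t.
Proof.
  intros Ht. apply Rle_trans with (h 0); [lra|]. apply ode_h_mono; lra.
Qed.

Lemma ode_h_late (t : R) : 1 <= t <= T0 -> m <= h t.
Proof.
  intros Ht.
  assert (H : h 0 - m * 0 <= h 1 - m * 1).
  { apply (derive_nonneg_le (fun s => h s - m * s) (fun s => k s - m)); [lra| | |].
    - intros s Hs. assert (Hhs := Dh s ltac:(lra)). evar_last.
      + apply (is_derive_minus h (fun s => m * s)); [exact Hhs|].
        auto_derive; [exact I|reflexivity].
      + unfold minus, plus, opp; simpl. ring.
    - intros s Hs. apply (continuity_pt_minus h (fun s => m * s)).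
      + apply Ch; lra.
      + apply is_derive_continuity_pt with m. auto_derive; [exact I|ring].
    - intros s Hs. assert (m <= k s) by (apply ode_k_early; lra). lra. }
  assert (h 1 <= h t) by (apply ode_h_mono; lra). lra.
Qed.

Lemma ode_m_pos : 0 < m.
Proof. apply Rmult_lt_0_compat; [lra|apply exp_pos]. Qed.

Lemma ode_kappa_pos : 0 < kappa.
Proof. apply Rdiv_lt_0_compat; pose proof ode_m_pos; lra. Qed.

(** The derivative of the barrier [Psi] is [Psi (q k / (h+1) - a / (t+B))].  Where
    [k <= Psi] it is at most [Psi (q delta (h+1)^(q-1) + |a|)], while the source is
    at least a multiple [1 / delta] of [Psi (h+1)^(p-q)].  The choice
    [q = (p+1)/2] makes the exponents [q-1] and [p-q] equal, so a small [delta]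
    settles the comparison uniformly in [h].  The power is taken of [h + 1]
    because [h] may vanish initially. *)
Lemma ode_barrier (t : R) :
  0 <= t <= T0 -> delta * mu * Rpower (h t + 1) q * w t <= k t.
Proof.
  pose proof ode_m_pos as Hm. pose proof ode_kappa_pos as Hkap.
  assert (Hq : 1 < q) by (unfold q; lra).
  intros Ht.
  set (Psi := fun s => delta * mu * Rpower (h s + 1) q * w s).
  set (dPsi := fun s => Psi s * (q * k s / (h s + 1) - a / (s + B))).
  enough (0 <= k t - Psi t) by (unfold Psi in *; lra).
  revert t Ht.
  apply (barrier (fun t => k t - Psi t) (fun t => k1 t - dPsi t)).
  - intros t Ht.
    assert (Hz := ode_h_nonneg t ltac:(lra)).
    apply (is_derive_minus k Psi); [now apply Dk|].
    unfold dPsi, Psi.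
    evar_last.
    + apply (is_derive_mult (fun s => delta * mu * Rpower (h s + 1) q) w).
      * apply (is_derive_scal (fun s => Rpower (h s + 1) q) t (delta * mu)).
        apply (is_derive_Rpower_comp (fun s => h s + 1)); [lra|].
        apply (is_derive_plus h (fun _ => 1)); [now apply Dh|].
        apply (is_derive_const (K := R_AbsRing) (V := R_NormedModule)).
      * apply (is_derive_Rpower_comp (fun s => s + B)); [lra|].
        auto_derive; [exact I|reflexivity].
      * intros; apply Rmult_comm.
    + unfold plus, mult, zero, w; simpl.
      replace (Rpower (h t + 1) (q - 1)) with (Rpower (h t + 1) q / (h t + 1)).
      2: { unfold Rminus. rewrite Rpower_plus, Rpower_Ropp, Rpower_1 by lra. reflexivity. }
      replace (Rpower (t + B) (- a - 1)) with (Rpower (t + B) (- a) / (t + B)).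
      2: { unfold Rminus. rewrite Rpower_plus, (Rpower_Ropp _ 1), Rpower_1 by lra. reflexivity. }
      field. lra.
  - intros t Ht.
    assert (Hz := ode_h_nonneg t ltac:(lra)).
    apply (continuity_pt_minus k Psi); [now apply Ck|].
    apply (continuity_pt_mult (fun s => delta * mu * Rpower (h s + 1) q) w).
    + apply (continuity_pt_scal (fun s => Rpower (h s + 1) q)).
      apply (continuity_pt_Rpower_comp (fun s => h s + 1)); [lra|].
      apply (continuity_pt_plus h (fun _ => 1)); [now apply Ch|].
      apply continuity_pt_const. intros x y; reflexivity.
    + apply (continuity_pt_Rpower_comp (fun s => s + B)); [lra|].
      apply is_derive_continuity_pt with 1. auto_derive; [exact I|ring].
  - unfold Psi. rewrite h0, k0.
    assert (Hw0 := hw 0 ltac:(lra)).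
    pose proof (Rpower_pos (c1 + 1) q).
    replace (delta * mu * Rpower (c1 + 1) q * w 0)
      with ((delta * Rpower (c1 + 1) q) * (mu * w 0)) by ring.
    assert (0 < delta * Rpower (c1 + 1) q) by (apply Rmult_lt_0_compat; lra).
    nra.
  - intros t Ht HD.
    assert (Hz := ode_h_nonneg t ltac:(lra)).
    assert (Hw := hw t ltac:(lra)).
    assert (Hkt := ode_k_pos t ltac:(lra)).
    assert (Hwp : 0 < mu * w t) by (apply Rmult_lt_0_compat; [lra|apply Rpower_pos]).
    destruct (Rlt_le_dec (h t) m) as [Hsmall|Hlarge].
    + exfalso.
      assert (t < 1).
      { destruct (Rlt_le_dec t 1); [assumption|].
        pose proof (ode_h_late t ltac:(lra)). lra. }
      assert (m <= k t) by (apply ode_k_early; lra).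
      assert (Rpower (h t + 1) q <= Rpower (m + 1) q) by (apply Rle_Rpower_l; lra).
      pose proof (Rpower_pos (h t + 1) q).
      unfold Psi in HD.
      replace (delta * mu * Rpower (h t + 1) q * w t)
        with ((delta * Rpower (h t + 1) q) * (mu * w t)) in HD by ring.
      assert (delta * Rpower (h t + 1) q <= delta * Rpower (m + 1) q)
        by (apply Rmult_le_compat_l; lra).
      assert (0 < delta * Rpower (h t + 1) q) by (apply Rmult_lt_0_compat; lra).
      nra.
    + set (z := h t + 1) in *.
      set (y := Rpower z (q - 1)).
      assert (Hy : 1 <= y) by (apply Rpower_base_le1; unfold z; lra).
      assert (HPsi : 0 < Psi t).
      { unfold Psi. fold z. replace (delta * mu * Rpower z q * w t)
          with (delta * Rpower z q * (mu * w t)) by ring.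
        apply Rmult_lt_0_compat; [|assumption].
        apply Rmult_lt_0_compat; [lra|apply Rpower_pos]. }
      assert (Hsrc : Psi t * ((2 + Rabs a + q * delta) * y) <= k1 t + 2 * k t).
      { apply Rle_trans with (2 := hk t ltac:(lra) ltac:(lra)).
        apply Rle_trans with (c * mu * Rpower (kappa * z) p * w t).
        - rewrite <- Rpower_mult_distr by (unfold z; lra).
          replace (Rpower z p) with (Rpower z q * y).
          2: { unfold y. rewrite <- Rpower_plus. f_equal. unfold q; field. }
          unfold Psi. fold z.
          replace (delta * mu * Rpower z q * w t * ((2 + Rabs a + q * delta) * y))
            with (delta * (2 + Rabs a + q * delta) * ((mu * w t) * Rpower z q * y)) by ring.
          replace (c * mu * (Rpower kappa p * (Rpower z q * y)) * w t)
            with (c * Rpower kappa p * ((mu * w t) * Rpower z q * y)) by ring.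
          apply Rmult_le_compat_r.
          + apply Rmult_le_pos; [|lra]. apply Rmult_le_pos; [lra|apply Rlt_le, Rpower_pos].
          + apply Rle_trans with (2 := hd1). apply Rmult_le_compat_l; [lra|].
            assert (q * delta <= q * 1) by (apply Rmult_le_compat_l; lra). lra.
        - assert (Hkz : kappa * z <= h t).
          { unfold kappa, z. apply Rmult_le_reg_r with (1 + m); [lra|].
            replace (m / (1 + m) * (h t + 1) * (1 + m)) with (m * (h t + 1)) by (field; lra).
            nra. }
          replace (c * mu * Rpower (kappa * z) p * w t)
            with (c * (mu * w t) * Rpower (kappa * z) p) by ring.
          replace (c * mu * Rpower (h t) p * w t)
            with (c * (mu * w t) * Rpower (h t) p) by ring.
          apply Rmult_le_compat_l; [apply Rlt_le, Rmult_lt_0_compat; lra|].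
          apply Rle_Rpower_l; [lra|]. split; [|assumption].
          apply Rmult_lt_0_compat; unfold z; lra. }
      assert (HkPsi : k t <= Psi t) by lra.
      assert (HPz : Psi t / z <= delta * y).
      { unfold Psi. fold z.
        replace (Rpower z q) with (z * y).
        2: { unfold y. rewrite <- (Rpower_1 z) at 1 by (unfold z; lra).
             rewrite <- Rpower_plus. f_equal. ring. }
        replace (delta * mu * (z * y) * w t / z) with (delta * y * (mu * w t))
          by (field; unfold z; lra).
        assert (0 < delta * y) by (apply Rmult_lt_0_compat; lra). nra. }
      assert (Hder : dPsi t <= Psi t * ((q * delta) * y + Rabs a)).
      { unfold dPsi. fold z. apply Rmult_le_compat_l; [lra|].
        assert (q * k t / z <= q * (delta * y)).
        { unfold Rdiv. rewrite Rmult_assoc. apply Rmult_le_compat_l; [lra|].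
          apply Rle_trans with (2 := HPz). apply Rmult_le_compat_r; [|assumption].
          apply Rlt_le, Rinv_0_lt_compat. unfold z; lra. }
        assert (- (a / (t + B)) <= Rabs a).
        { apply Rmult_le_reg_r with (t + B); [lra|].
          replace (- (a / (t + B)) * (t + B)) with (- a) by (field; lra).
          pose proof (Rle_abs (- a)) as Habs. rewrite Rabs_Ropp in Habs.
          pose proof (Rabs_pos a). nra. }
        lra. }
      assert (Psi t * (q * delta * y + Rabs a) + 2 * Psi t
              <= Psi t * ((2 + Rabs a + q * delta) * y)).
      { pose proof (Rabs_pos a).
        replace (Psi t * (q * delta * y + Rabs a) + 2 * Psi t)
          with (Psi t * (q * delta * y + Rabs a + 2)) by ring.
        apply Rmult_le_compat_l; [lra|]. nra. }
      lra.
Qed.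

(** The barrier integrated: [(h+1)^(1-q)] loses at least
    [(q-1) delta mu (Theta T0 - Theta 0)] and stays in [(0, 1]]. *)
Lemma ode_time_bound (Theta : R -> R) :
  (forall t, 0 <= t -> is_derive Theta t (w t)) ->
  (q - 1) * delta * mu * (Theta T0 - Theta 0) <= 1.
Proof.
  intros HT.
  assert (Hq : 1 < q) by (unfold q; lra).
  set (J := fun t => - Rpower (h t + 1) (1 - q) - (q - 1) * delta * mu * Theta t).
  assert (HJ : J 0 <= J T0).
  { apply (derive_nonneg_le J
      (fun t => (q - 1) * (k t * Rpower (h t + 1) (- q) - delta * mu * w t))); [lra| | |].
    - intros t Ht. assert (Hz := ode_h_nonneg t ltac:(lra)).
      unfold J. evar_last.
      + apply (is_derive_minus (fun t => - Rpower (h t + 1) (1 - q))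
                 (fun t => (q - 1) * delta * mu * Theta t)).
        * apply (is_derive_opp (fun t => Rpower (h t + 1) (1 - q))).
          apply (is_derive_Rpower_comp (fun s => h s + 1)); [lra|].
          apply (is_derive_plus h (fun _ => 1)); [now apply Dh|].
          apply (is_derive_const (K := R_AbsRing) (V := R_NormedModule)).
        * apply (is_derive_scal Theta t ((q - 1) * delta * mu)). apply HT. lra.
      + unfold minus, plus, opp, zero; simpl.
        replace (1 - q - 1) with (- q) by ring. ring.
    - intros t Ht. assert (Hz := ode_h_nonneg t ltac:(lra)).
      apply (continuity_pt_minus (fun t => - Rpower (h t + 1) (1 - q))
                 (fun t => (q - 1) * delta * mu * Theta t)).
      + apply (continuity_pt_opp (fun t => Rpower (h t + 1) (1 - q))).
        apply (continuity_pt_Rpower_comp (fun s => h s + 1)); [lra|].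
        apply (continuity_pt_plus h (fun _ => 1)); [now apply Ch|].
        apply continuity_pt_const. intros x y; reflexivity.
      + apply (continuity_pt_scal Theta). eapply is_derive_continuity_pt. apply HT. lra.
    - intros t Ht. assert (Hz := ode_h_nonneg t ltac:(lra)).
      apply Rmult_le_pos; [lra|].
      assert (Hb := ode_barrier t ltac:(lra)).
      assert (delta * mu * w t = delta * mu * Rpower (h t + 1) q * w t * Rpower (h t + 1) (- q)).
      { replace (delta * mu * Rpower (h t + 1) q * w t * Rpower (h t + 1) (- q))
          with (delta * mu * w t * (Rpower (h t + 1) q * Rpower (h t + 1) (- q))) by ring.
        rewrite <- Rpower_plus, Rplus_opp_r, Rpower_O by lra. ring. }
      rewrite H. pose proof (Rpower_pos (h t + 1) (- q)). nra. }
  unfold J in HJ.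
  pose proof (Rpower_pos (h T0 + 1) (1 - q)).
  assert (Rpower (h 0 + 1) (1 - q) <= 1).
  { rewrite h0. apply Rle_trans with (Rpower (c1 + 1) 0).
    - apply Rle_Rpower; lra.
    - rewrite Rpower_O; lra. }
  lra.
Qed.
End Ode.

Lemma Rpower_neg_pow_le (x s e M : R) :
  0 < e -> 0 < M -> 0 < x -> x <= Rpower M (- / e) -> s = - e ->
  M <= Rpower x s.
Proof.
  intros He HM Hx Hle ->.
  apply Rle_trans with (Rpower (Rpower M (- / e)) (- e)).
  - rewrite Rpower_mult. replace (- / e * - e) with 1 by (field; lra).
    rewrite Rpower_1; lra.
  - rewrite !Rpower_Ropp. apply Rinv_le_contravar; [apply Rpower_pos|].
    rewrite <- !Rpower_Ropp. apply Rle_Rpower_l; lra.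
Qed.

Lemma ode_constants (p a c c0 c1 : R) :
  1 < p -> 0 < c -> 0 < c0 -> 0 <= c1 ->
  let q := (p + 1) / 2 in let m := c0 * exp (-2) in
  exists delta, 0 < delta <= 1 /\
    delta * (2 + Rabs a + q) <= c * Rpower (m / (1 + m)) p /\
    2 * (delta * Rpower (m + 1) q) <= m /\ delta * Rpower (c1 + 1) q <= c0.
Proof.
  intros hp hc hc0 hc1 q m.
  assert (Hm : 0 < m) by (apply Rmult_lt_0_compat; [lra|apply exp_pos]).
  pose proof (Rabs_pos a). pose proof (Rpower_pos (m / (1 + m)) p) as P1.
  pose proof (Rpower_pos (m + 1) q) as P2. pose proof (Rpower_pos (c1 + 1) q) as P3.
  assert (Hs : 0 < 2 + Rabs a + q) by (unfold q; lra).
  set (X1 := c * Rpower (m / (1 + m)) p) in *.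
  assert (HX1 : 0 < X1) by (apply Rmult_lt_0_compat; lra).
  exists (Rmin 1 (Rmin (X1 / (2 + Rabs a + q))
           (Rmin (m / (2 * Rpower (m + 1) q)) (c0 / Rpower (c1 + 1) q)))).
  set (dl := Rmin 1 _).
  assert (D1 : dl <= 1) by apply Rmin_l.
  assert (D2 : dl <= X1 / (2 + Rabs a + q)).
  { eapply Rle_trans; [apply Rmin_r|apply Rmin_l]. }
  assert (D3 : dl <= m / (2 * Rpower (m + 1) q)).
  { eapply Rle_trans; [apply Rmin_r|]. eapply Rle_trans; [apply Rmin_r|apply Rmin_l]. }
  assert (D4 : dl <= c0 / Rpower (c1 + 1) q).
  { eapply Rle_trans; [apply Rmin_r|]. eapply Rle_trans; [apply Rmin_r|apply Rmin_r]. }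
  assert (D0 : 0 < dl).
  { repeat apply Rmin_pos; try apply Rdiv_lt_0_compat; lra. }
  apply Rle_div_r in D2; [|lra]. apply Rle_div_r in D3; [|lra]. apply Rle_div_r in D4; [|lra].
  repeat split; lra.
Qed.

(** This fixes the lifespan.  For [a < 1] write [E = eps^(-(p-1)/(1-a))], so that
    [mu = E^-(1-a)] and [T0 = C E]: then [mu T0^(1-a)] is [C^(1-a)] whatever
    [eps] is, and [mu (T0+B)^-a <= (C+B)^-a / E] for [a < 0], which is at most [1]
    once [eps] is small.  For [a = 1] the primitive is a logarithm and
    [mu ln T0 = C]. *)
Lemma ode_time_choice (p a B eta : R) :
  1 < p -> a <= 1 -> 1 <= B -> 0 < eta ->
  exists eps1 C Theta, 0 < eps1 <= 1 /\ 0 < C /\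
    (forall t, 0 <= t -> is_derive Theta t (Rpower (t + B) (- a))) /\
    forall eps, 0 < eps <= eps1 ->
      let T0 := lifespan_bound p a C eps in let mu := Rpower eps (p - 1) in
      0 <= T0 /\ (forall t, 0 <= t <= T0 -> mu * Rpower (t + B) (- a) <= 1) /\
      1 < eta * mu * (Theta T0 - Theta 0).
Proof.
  intros hp ha hB heta.
  assert (Hmu1 : forall eps, 0 < eps <= 1 -> Rpower eps (p - 1) <= 1).
  { intros eps He. apply Rle_trans with (Rpower 1 (p - 1)).
    - apply Rle_Rpower_l; lra.
    - unfold Rpower. rewrite ln_1, Rmult_0_r, exp_0. lra. }
  assert (Hneg : 0 <= a -> forall eps, 0 < eps <= 1 -> forall t, 0 <= t ->
            Rpower eps (p - 1) * Rpower (t + B) (- a) <= 1).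
  { intros Ha eps He t Ht.
    assert (Rpower (t + B) (- a) <= 1).
    { rewrite Rpower_Ropp, <- Rinv_1. apply Rinv_le_contravar; [lra|].
      apply Rpower_base_le1; lra. }
    pose proof (Hmu1 eps He). pose proof (Rpower_pos eps (p - 1)).
    pose proof (Rpower_pos (t + B) (- a)). nra. }
  destruct (Rle_lt_or_eq_dec a 1 ha) as [Ha|Ha].
  - set (C := Rpower (Rpower B (1 - a) + 2 * ((1 - a) / eta)) (/ (1 - a))).
    assert (HC : 0 < C) by apply Rpower_pos.
    assert (HCpow : Rpower C (1 - a) = Rpower B (1 - a) + 2 * ((1 - a) / eta)).
    { unfold C. rewrite Rpower_mult. replace (/ (1 - a) * (1 - a)) with 1 by (field; lra).
      apply Rpower_1. pose proof (Rpower_pos B (1 - a)).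
      assert (0 < (1 - a) / eta) by (apply Rdiv_lt_0_compat; lra). lra. }
    assert (HM : 0 < Rpower (C + B) (- a)) by apply Rpower_pos.
    exists (Rmin 1 (Rpower (Rpower (C + B) (- a)) (- / ((p - 1) / (1 - a))))).
    exists C, (fun t => / (1 - a) * Rpower (t + B) (1 - a)).
    split; [split; [apply Rmin_pos; [lra|apply Rpower_pos]|apply Rmin_l]|].
    split; [assumption|]. split.
    { intros t Ht. evar_last.
      - apply (is_derive_scal (fun t => Rpower (t + B) (1 - a)) t (/ (1 - a))).
        apply (is_derive_Rpower_comp (fun s => s + B)); [lra|].
        auto_derive; [exact I|reflexivity].
      - simpl.
        replace (1 - a - 1) with (- a) by ring. field. lra. }
    intros eps [He0 He1].
    assert (He : eps <= 1) by (eapply Rle_trans; [exact He1|apply Rmin_l]).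
    set (E := Rpower eps (- (p - 1) / (1 - a))).
    intros T0 mu.
    assert (HT0 : T0 = C * E).
    { unfold T0, lifespan_bound. destruct (Rlt_dec a 1); [reflexivity|lra]. }
    assert (HE0 : 0 < E) by apply Rpower_pos.
    assert (HpE : 0 < (p - 1) / (1 - a)) by (apply Rdiv_lt_0_compat; lra).
    assert (HEM : Rpower (C + B) (- a) <= E).
    { unfold E. apply (Rpower_neg_pow_le eps _ ((p - 1) / (1 - a))); try assumption.
      - eapply Rle_trans; [exact He1|apply Rmin_r].
      - field. lra. }
    assert (HE1 : 1 <= E).
    { unfold E. apply (Rpower_neg_pow_le eps _ ((p - 1) / (1 - a))); try assumption; try lra.
      replace (Rpower 1 _) with 1; [assumption|].
      unfold Rpower. rewrite ln_1, Rmult_0_r, exp_0. reflexivity. }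
    assert (HmuE : mu = Rpower E (- (1 - a))).
    { unfold mu, E. rewrite Rpower_mult. f_equal. field. lra. }
    split; [rewrite HT0; apply Rlt_le, Rmult_lt_0_compat; lra|]. split.
    + intros t Ht. destruct (Rle_lt_dec 0 a) as [Ha0|Ha0]; [apply Hneg; lra|].
      assert (Rpower (t + B) (- a) <= Rpower (C + B) (- a) * Rpower E (- a)).
      { rewrite Rpower_mult_distr by lra. apply Rle_Rpower_l; [lra|].
        rewrite HT0 in Ht. nra. }
      apply Rle_trans with (mu * (E * Rpower E (- a))).
      * apply Rmult_le_compat_l; [apply Rlt_le, Rpower_pos|].
        eapply Rle_trans; [exact H|]. apply Rmult_le_compat_r; [|assumption].
        apply Rlt_le, Rpower_pos.
      * rewrite HmuE. rewrite <- (Rpower_1 E) at 2 by assumption.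
        rewrite <- !Rpower_plus.
        replace (- (1 - a) + (1 + - a)) with 0 by ring. rewrite Rpower_O; lra.
    + rewrite HT0.
      assert (Hmup : 0 < mu) by apply Rpower_pos.
      assert (G1 : Rpower C (1 - a) <= mu * Rpower (C * E + B) (1 - a)).
      { apply Rle_trans with (mu * Rpower (C * E) (1 - a)).
        - rewrite <- Rpower_mult_distr, HmuE by assumption.
          replace (Rpower E (- (1 - a)) * (Rpower C (1 - a) * Rpower E (1 - a)))
            with (Rpower C (1 - a) * (Rpower E (- (1 - a)) * Rpower E (1 - a))) by ring.
          rewrite <- Rpower_plus. replace (- (1 - a) + (1 - a)) with 0 by ring.
          rewrite Rpower_O; lra.
        - apply Rmult_le_compat_l; [lra|]. apply Rle_Rpower_l; [lra|].
          assert (0 < C * E) by (apply Rmult_lt_0_compat; lra). lra. }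
      assert (G2 : mu * Rpower (0 + B) (1 - a) <= Rpower B (1 - a)).
      { rewrite Rplus_0_l. pose proof (Hmu1 eps ltac:(lra)) as Hm1. fold mu in Hm1.
        pose proof (Rpower_pos B (1 - a)). nra. }
      replace (eta * mu * (/ (1 - a) * Rpower (C * E + B) (1 - a) - / (1 - a) * Rpower (0 + B) (1 - a)))
        with (eta / (1 - a) * (mu * Rpower (C * E + B) (1 - a) - mu * Rpower (0 + B) (1 - a)))
        by (field; lra).
      apply Rlt_le_trans with (eta / (1 - a) * (2 * ((1 - a) / eta))).
      * replace (eta / (1 - a) * (2 * ((1 - a) / eta))) with 2 by (field; lra). lra.
      * apply Rmult_le_compat_l; [apply Rlt_le, Rdiv_lt_0_compat; lra|]. lra.
  - subst a.
    assert (HlnB : 0 <= ln B).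
    { rewrite <- ln_1. destruct (Req_dec B 1) as [->|]; [lra|].
      apply Rlt_le, ln_increasing; lra. }
    assert (Heta : 0 < / eta) by (apply Rinv_0_lt_compat; lra).
    exists 1, (ln B + 2 * / eta), (fun t => ln (t + B)).
    split; [lra|]. split; [lra|]. split.
    { intros t Ht. replace (Rpower (t + B) (- (1))) with (/ (t + B)).
      2: { rewrite Rpower_Ropp, Rpower_1; lra. }
      auto_derive; [lra|]. field. lra. }
    intros eps He T0 mu.
    assert (HT0 : T0 = exp ((ln B + 2 * / eta) * / mu)).
    { unfold T0, lifespan_bound. destruct (Rlt_dec 1 1); [lra|].
      rewrite Rpower_Ropp. reflexivity. }
    assert (Hmup : 0 < mu) by apply Rpower_pos.
    split; [rewrite HT0; apply Rlt_le, exp_pos|]. split.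
    + intros t Ht. apply Hneg; lra.
    + rewrite HT0, Rplus_0_l.
      set (X := (ln B + 2 * / eta) * / mu).
      assert (HX : X <= ln (exp X + B)).
      { rewrite <- (ln_exp X) at 1. apply Rlt_le, ln_increasing; [apply exp_pos|lra]. }
      assert (Hm1 := Hmu1 eps He). fold mu in Hm1.
      assert (mu * X = ln B + 2 * / eta) by (unfold X; field; lra).
      apply Rlt_le_trans with (eta * (2 * / eta)).
      * replace (eta * (2 * / eta)) with 2 by (field; lra). lra.
      * rewrite Rmult_assoc. apply Rmult_le_compat_l; [lra|].
        assert (mu * X <= mu * ln (exp X + B)) by (apply Rmult_le_compat_l; lra).
        assert (mu * ln B <= ln B) by nra. lra.
Qed.

(** Dividing by [eps] turns the data into constants and the factor [c] of the
    source into [c eps^(p-1)]. *)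
Lemma ode_blow_up (p a B c c0 c1 : R) :
  1 < p -> a <= 1 -> 1 <= B -> 0 < c -> 0 < c0 -> 0 <= c1 ->
  exists eps1 C, 0 < eps1 /\ 0 < C /\
    forall eps, 0 < eps <= eps1 -> forall T, T > lifespan_bound p a C eps ->
    forall H K K1 : R -> R,
      (forall t, 0 <= t < T -> continuity_pt H t) ->
      (forall t, 0 <= t < T -> continuity_pt K t) ->
      (forall t, 0 < t < T -> is_derive H t (K t)) ->
      (forall t, 0 < t < T -> is_derive K t (K1 t)) ->
      H 0 = eps * c1 -> K 0 = eps * c0 ->
      (forall t, 0 < t < T -> 0 <= K1 t + 2 * K t) ->
      (forall t, 0 < t < T -> 0 < H t ->
         c * Rpower (H t) p * Rpower (t + B) (- a) <= K1 t + 2 * K t) ->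
      False.
Proof.
  intros hp ha hB hc hc0 hc1.
  destruct (ode_constants p a c c0 c1 hp hc hc0 hc1) as [delta [hd [hd1 [hd2 hd3]]]].
  destruct (ode_time_choice p a B (((p + 1) / 2 - 1) * delta) hp ha hB)
    as [eps1 [C [Theta [Heps1 [HC [HTheta Hmain]]]]]].
  { apply Rmult_lt_0_compat; lra. }
  exists eps1, C. split; [lra|]. split; [assumption|].
  intros eps Heps T HT H K K1 CH CK DH DK H0 K0 Hpos Hsrc.
  destruct (Hmain eps Heps) as [HT0 [Hw Hbig]].
  set (T0 := lifespan_bound p a C eps) in *.
  set (mu := Rpower eps (p - 1)) in *.
  assert (Hie : 0 < / eps) by (apply Rinv_0_lt_compat; lra).
  assert (Hbound : ((p + 1) / 2 - 1) * delta * mu * (Theta T0 - Theta 0) <= 1); [|lra].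
  apply (ode_time_bound p a B c c0 c1 delta mu T0
    (fun t => / eps * H t) (fun t => / eps * K t) (fun t => / eps * K1 t)); try assumption.
  - apply Rpower_pos.
  - intros t Ht. apply (continuity_pt_scal H). apply CH. lra.
  - intros t Ht. apply (continuity_pt_scal K). apply CK. lra.
  - intros t Ht. apply (is_derive_scal H t (/ eps)). apply DH. lra.
  - intros t Ht. apply (is_derive_scal K t (/ eps)). apply DK. lra.
  - rewrite H0. field. lra.
  - rewrite K0. field. lra.
  - intros t Ht. pose proof (Hpos t ltac:(lra)).
    replace (/ eps * K1 t + 2 * (/ eps * K t)) with (/ eps * (K1 t + 2 * K t)) by ring.
    apply Rmult_le_pos; lra.
  - intros t Ht Hh.
    assert (HHt : 0 < H t).
    { replace (H t) with (eps * (/ eps * H t)) by (field; lra).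
      apply Rmult_lt_0_compat; lra. }
    pose proof (Hsrc t ltac:(lra) HHt).
    replace (/ eps * K1 t + 2 * (/ eps * K t)) with (/ eps * (K1 t + 2 * K t)) by ring.
    apply Rle_trans with (/ eps * (c * Rpower (H t) p * Rpower (t + B) (- a))).
    2: apply Rmult_le_compat_l; lra.
    apply Req_le.
    replace (Rpower (H t) p) with (Rpower eps p * Rpower (/ eps * H t) p).
    2: { rewrite Rpower_mult_distr by (try lra; assumption). f_equal. field. lra. }
    replace (Rpower eps p) with (eps * mu).
    2: { unfold mu. rewrite <- (Rpower_1 eps) at 1 by lra. rewrite <- Rpower_plus.
         f_equal. ring. }
    field. lra.
Qed.

(** * Regularity of classical solutions *)

(** Continuity up to the initial time, made two-sided by reflecting [t] at [0]. *)
Definition cont_strip (T : R) (h : R -> R -> R) : Prop :=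
  forall x t, Rabs t < T -> continuity_2d_pt (fun y s => h y (Rabs s)) x t.

Lemma continuous_on_cont_strip (T : R) (h : R -> R -> R) :
  continuous_on (strip T) (fun z : R * R => h (fst z) (snd z)) -> cont_strip T h.
Proof.
  intros H x t Ht eps.
  assert (Hst : strip T (x, Rabs t)).
  { split; simpl; [apply Rabs_pos|assumption]. }
  destruct (H (x, Rabs t) Hst (ball (h x (Rabs t)) eps)) as [d Hd].
  { now exists eps. }
  assert (Hpos : 0 < Rmin d (T - Rabs t)) by (apply Rmin_pos; [apply cond_pos|lra]).
  exists (mkposreal _ Hpos). simpl. intros y s Hy Hs.
  assert (Hss : Rabs (Rabs s - Rabs t) <= Rabs (s - t)) by apply Rabs_triang_inv2.
  pose proof (Rmin_l d (T - Rabs t)). pose proof (Rmin_r d (T - Rabs t)).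
  apply (Hd (y, Rabs s)).
  - split; unfold ball; simpl; unfold AbsRing_ball, abs, minus, plus, opp; simpl.
    + change (Rabs (y - x) < d). lra.
    + change (Rabs (Rabs s - Rabs t) < d). lra.
  - split; simpl; [apply Rabs_pos|].
    pose proof (Rle_abs (Rabs s - Rabs t)). lra.
Qed.

Lemma locally_2d_interior (T x t : R) (P : R -> R -> Prop) :
  0 < t < T -> (forall y s, 0 < s < T -> P y s) -> locally_2d P x t.
Proof.
  intros Ht HP.
  assert (Hpos : 0 < Rmin t (T - t)) by (apply Rmin_pos; lra).
  exists (mkposreal _ Hpos). simpl. intros y s _ Hs. apply HP.
  pose proof (Rmin_l t (T - t)). pose proof (Rmin_r t (T - t)).
  apply Rabs_lt_between in Hs. lra.
Qed.

Lemma locally_interior (T t : R) (P : R -> Prop) :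
  0 < t < T -> (forall s, 0 < s < T -> P s) -> locally t P.
Proof.
  intros Ht HP.
  assert (Hpos : 0 < Rmin t (T - t)) by (apply Rmin_pos; lra).
  exists (mkposreal _ Hpos). intros s Hs. apply HP.
  change (Rabs (s - t) < Rmin t (T - t)) in Hs.
  pose proof (Rmin_l t (T - t)). pose proof (Rmin_r t (T - t)).
  apply Rabs_lt_between in Hs. lra.
Qed.

Lemma cont_strip_interior (T : R) (h : R -> R -> R) (x t : R) :
  cont_strip T h -> 0 < t < T -> continuity_2d_pt h x t.
Proof.
  intros H Ht.
  apply (continuity_2d_pt_ext_loc (fun y s => h y (Rabs s))).
  - apply (locally_2d_interior T); [assumption|].
    intros y s Hs. rewrite Rabs_pos_eq; [reflexivity|lra].
  - apply H. rewrite Rabs_pos_eq; lra.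
Qed.

Lemma cont_strip_x (T : R) (h : R -> R -> R) (x t : R) :
  cont_strip T h -> 0 <= t < T -> continuous (fun y => h y t) x.
Proof.
  intros H Ht.
  assert (HC := H x t ltac:(rewrite Rabs_pos_eq; lra)).
  apply continuity_pt_filterlim.
  intros e He. destruct (HC (mkposreal e He)) as [d Hd].
  exists d. split; [apply cond_pos|]. intros y [_ Hy].
  specialize (Hd y t Hy). rewrite (Rabs_pos_eq t) in Hd by lra.
  apply Hd. rewrite Rminus_eq_0, Rabs_R0. apply cond_pos.
Qed.

Lemma cont_strip_t (T : R) (h : R -> R -> R) (x t : R) :
  cont_strip T h -> 0 <= t < T -> continuity_pt (fun s => h x (Rabs s)) t.
Proof.
  intros H Ht.
  assert (HC := H x t ltac:(rewrite Rabs_pos_eq; lra)).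
  intros e He. destruct (HC (mkposreal e He)) as [d Hd].
  exists d. split; [apply cond_pos|]. intros s [_ Hs].
  apply (Hd x s); [|exact Hs]. rewrite Rminus_eq_0, Rabs_R0. apply cond_pos.
Qed.

Lemma D_in_is_derive (T t : R) (F d : R -> R) :
  D_in F d (time_interval T) t -> 0 < t < T -> is_derive F t (d t).
Proof.
  intros H Ht. apply is_derive_Reals. intros e He.
  destruct (H e He) as [al [Hal Hd]].
  assert (Hpos : 0 < Rmin al (Rmin t (T - t))) by (repeat apply Rmin_pos; lra).
  exists (mkposreal _ Hpos). simpl. intros s Hs0 Hs.
  pose proof (Rmin_l al (Rmin t (T - t))). pose proof (Rmin_r al (Rmin t (T - t))).
  pose proof (Rmin_l t (T - t)). pose proof (Rmin_r t (T - t)).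
  replace ((F (t + s) - F t) / s) with ((F (t + s) - F t) / (t + s - t))
    by (f_equal; ring).
  apply (Hd (t + s)). split.
  - split; [|lra]. apply Rabs_lt_between in Hs. unfold time_interval. lra.
  - simpl. unfold Rdist. replace (t + s - t) with s by ring. lra.
Qed.

Lemma D_in_unique (T t : R) (F d1 d2 : R -> R) :
  time_interval T t ->
  D_in F d1 (time_interval T) t -> D_in F d2 (time_interval T) t -> d1 t = d2 t.
Proof.
  intros Ht H1 H2. refine (single_limit _ _ _ _ _ _ H1 H2).
  intros al Hal. unfold time_interval in Ht.
  assert (Hpos : 0 < Rmin al (T - t)) by (apply Rmin_pos; lra).
  pose proof (Rmin_l al (T - t)). pose proof (Rmin_r al (T - t)).
  exists (t + Rmin al (T - t) / 2). split.
  - split; [unfold time_interval; lra|lra].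
  - unfold Rdist. replace (t + Rmin al (T - t) / 2 - t) with (Rmin al (T - t) / 2) by ring.
    rewrite Rabs_pos_eq; lra.
Qed.

(** The derivatives supplied by the regularity of [u] and those appearing in the
    equation are separate existential witnesses; here they are merged, and time
    derivatives become two-sided ones at positive times. *)
Record regular_solution (p a : R) (u0 u1 : R -> R) (T : R)
    (u ux ut uxx uxt utt : R -> R -> R) : Prop := {
  rs_cu : cont_strip T u;
  rs_cux : cont_strip T ux;
  rs_cut : cont_strip T ut;
  rs_cuxx : cont_strip T uxx;
  rs_cuxt : cont_strip T uxt;
  rs_cutt : cont_strip T utt;
  rs_dx_u : forall x t, 0 <= t < T -> is_derive (fun y => u y t) x (ux x t);
  rs_dx_ux : forall x t, 0 <= t < T -> is_derive (fun y => ux y t) x (uxx x t);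
  rs_dx_ut : forall x t, 0 < t < T -> is_derive (fun y => ut y t) x (uxt x t);
  rs_dt_u : forall x t, 0 < t < T -> is_derive (u x) t (ut x t);
  rs_dt_ux : forall x t, 0 < t < T -> is_derive (ux x) t (uxt x t);
  rs_dt_ut : forall x t, 0 < t < T -> is_derive (ut x) t (utt x t);
  rs_eq : forall x t, 0 < t < T ->
    utt x t - uxx x t = abs_pow (ux x t) p / Rpower (japanese x) a;
  rs_u0 : forall x, u x 0 = u0 x;
  rs_u1 : forall x, ut x 0 = u1 x
}.

Lemma mixed_partials_eq (T : R) (u ux ut uxt utx : R -> R -> R) :
  cont_strip T uxt -> cont_strip T utx ->
  (forall x t, 0 < t < T -> is_derive (fun y => u y t) x (ux x t)) ->
  (forall x t, 0 < t < T -> is_derive (u x) t (ut x t)) ->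
  (forall x t, 0 < t < T -> is_derive (ux x) t (uxt x t)) ->
  (forall x t, 0 < t < T -> is_derive (fun y => ut y t) x (utx x t)) ->
  forall x t, 0 < t < T -> utx x t = uxt x t.
Proof.
  intros C1 C2 Hux Hut Huxt Hutx x t Ht.
  assert (E1 : forall s, 0 < s < T -> forall z, Derive (fun r => u z r) s = ut z s).
  { intros s Hs z. apply is_derive_unique. now apply Hut. }
  assert (D1 : forall y s, 0 < s < T ->
            is_derive (fun z => Derive (fun r => u z r) s) y (utx y s)).
  { intros y s Hs. apply is_derive_ext with (fun z => ut z s).
    - intros z. symmetry. now apply E1.
    - now apply Hutx. }
  assert (D2 : forall y s, 0 < s < T ->
            is_derive (fun z => Derive (fun r => u r z) y) s (uxt y s)).
  { intros y s Hs. apply is_derive_ext_loc with (ux y).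
    - apply (locally_interior T); [assumption|]. intros z Hz. symmetry.
      apply is_derive_unique. now apply Hux.
    - now apply Huxt. }
  assert (HS := Schwarz u x t).
  rewrite <- (is_derive_unique _ _ _ (D1 x t Ht)), <- (is_derive_unique _ _ _ (D2 x t Ht)).
  apply HS.
  - apply (locally_2d_interior T); [assumption|]. intros y s Hs.
    repeat split; eexists; [now apply Hux|now apply Hut|now apply D1|now apply D2].
  - apply (continuity_2d_pt_ext_loc utx).
    + apply (locally_2d_interior T); [assumption|]. intros y s Hs.
      symmetry. now apply is_derive_unique, D1.
    + now apply (cont_strip_interior T).
  - apply (continuity_2d_pt_ext_loc uxt).
    + apply (locally_2d_interior T); [assumption|]. intros y s Hs.
      symmetry. now apply is_derive_unique, D2.
    + now apply (cont_strip_interior T).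
Qed.

Lemma classical_regular (p a : R) (u0 u1 : R -> R) (T : R) (u : R -> R -> R) :
  0 < T -> classical_solution p a u0 u1 T u ->
  exists ux ut uxx uxt utt, regular_solution p a u0 u1 T u ux ut uxx uxt utt.
Proof.
  intros HT [[Cu [ux [ut [Dxu [Dtu [Rux Rut]]]]]]
    [vx [vxx [vt [vtt [Dxv [Dxvx [Dtv [Dtvt [Heq [Hu0 Hu1]]]]]]]]]]].
  destruct Rux as [Cux [uxx [uxt [Dxux [Dtux [[Cuxx _] [Cuxt _]]]]]]].
  destruct Rut as [Cut [utx [utt [Dxut [Dtut [[Cutx _] [Cutt _]]]]]]].
  exists ux, ut, uxx, uxt, utt.
  assert (Ex : forall x t, 0 <= t < T -> vx x t = ux x t).
  { intros x t Ht. rewrite <- (is_derive_unique _ _ _ (Dxv x t Ht)).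
    now apply is_derive_unique, Dxu. }
  assert (Exx : forall x t, 0 <= t < T -> vxx x t = uxx x t).
  { intros x t Ht. rewrite <- (is_derive_unique _ _ _ (Dxvx x t Ht)).
    apply is_derive_unique. apply is_derive_ext with (fun y => ux y t).
    - intros y. symmetry. now apply Ex.
    - now apply Dxux. }
  assert (Et : forall x t, 0 <= t < T -> vt x t = ut x t).
  { intros x t Ht. apply (D_in_unique T t (u x)); [assumption|now apply Dtv|now apply Dtu]. }
  assert (HTt : forall x t, 0 < t < T -> is_derive (u x) t (ut x t)).
  { intros x t Ht. apply (D_in_is_derive T); [apply Dtu; unfold time_interval; lra|lra]. }
  assert (HTtt : forall x t, 0 < t < T -> is_derive (ut x) t (utt x t)).
  { intros x t Ht. apply (D_in_is_derive T); [apply Dtut; unfold time_interval; lra|lra]. }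
  assert (HTxt : forall x t, 0 < t < T -> is_derive (ux x) t (uxt x t)).
  { intros x t Ht. apply (D_in_is_derive T); [apply Dtux; unfold time_interval; lra|lra]. }
  assert (Ett : forall x t, 0 < t < T -> vtt x t = utt x t).
  { intros x t Ht.
    assert (Hd : is_derive (vt x) t (vtt x t)).
    { apply (D_in_is_derive T); [apply Dtvt; unfold time_interval; lra|lra]. }
    rewrite <- (is_derive_unique _ _ _ Hd). apply is_derive_unique.
    apply is_derive_ext_loc with (ut x); [|now apply HTtt].
    apply (locally_interior T); [assumption|]. intros s Hs. symmetry. apply Et. lra. }
  apply continuous_on_cont_strip in Cu, Cux, Cut, Cuxx, Cuxt, Cutt, Cutx.
  constructor; try assumption.
  - intros x t Ht. rewrite <- (mixed_partials_eq T u ux ut uxt utx); try assumption.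
    + apply Dxut. unfold time_interval; lra.
    + intros y s Hs. apply Dxu. unfold time_interval; lra.
    + intros y s Hs. apply Dxut. unfold time_interval; lra.
  - intros x t Ht. rewrite <- Ett, <- Exx, <- Ex by lra. now apply Heq.
  - intros x. rewrite <- Et by lra. apply Hu1.
Qed.

(** Uniform continuity on the rectangle bounds the oscillation along each step of
    a walk with a fixed number of short steps. *)
Lemma cont_strip_bounded (T : R) (h : R -> R -> R) (x1 x2 t0 : R) :
  cont_strip T h -> x1 <= x2 -> 0 <= t0 < T ->
  exists M, 0 < M /\ forall x t, x1 <= x <= x2 -> 0 <= t <= t0 -> Rabs (h x t) <= M.
Proof.
  intros HC Hx Ht0.
  destruct (uniform_continuity_2d (fun x t => h x (Rabs t)) x1 x2 0 t0) with (eps := mkposreal 1 Rlt_0_1)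
    as [d Hd].
  { intros x t _ Ht. apply HC. rewrite Rabs_pos_eq; lra. }
  destruct (nfloor_ex ((x2 - x1 + t0) / d)) as [n [_ Hn]].
  { apply Rdiv_le_0_compat; [lra|apply cond_pos]. }
  set (N := INR n + 1) in *.
  assert (HN : 0 < N) by (pose proof (pos_INR n); unfold N; lra).
  assert (HNd : (x2 - x1 + t0) / N < d).
  { apply Rlt_div_l; [assumption|]. apply Rlt_div_l in Hn; [lra|apply cond_pos]. }
  exists (Rabs (h x1 0) + N). split; [pose proof (Rabs_pos (h x1 0)); lra|].
  intros x t Hxx Ht.
  assert (Hwalk : forall k, INR k <= N ->
    Rabs (h (x1 + INR k / N * (x - x1)) (INR k / N * t)) <= Rabs (h x1 0) + INR k).
  { induction k as [|k IH]; intros Hk.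
    - simpl. unfold Rdiv. rewrite !Rmult_0_l, !Rplus_0_r. apply Rle_refl.
    - rewrite S_INR in *. specialize (IH ltac:(lra)).
      assert (Hk0 : 0 <= INR k / N) by (apply Rdiv_le_0_compat; [apply pos_INR|lra]).
      assert (Hk1 : (INR k + 1) / N <= 1) by (apply Rle_div_l; lra).
      assert (Hkk : (INR k + 1) / N = INR k / N + / N) by (field; lra).
      assert (HiN : 0 < / N) by now apply Rinv_0_lt_compat.
      rewrite Hkk in *. set (al := INR k / N) in *.
      assert (HxN : 0 <= / N * (x - x1) < d).
      { split; [apply Rmult_le_pos; lra|]. apply Rle_lt_trans with (2 := HNd).
        unfold Rdiv. rewrite Rmult_comm. apply Rmult_le_compat_r; lra. }
      assert (HtN : 0 <= / N * t < d).
      { split; [apply Rmult_le_pos; lra|]. apply Rle_lt_trans with (2 := HNd).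
        unfold Rdiv. rewrite Rmult_comm. apply Rmult_le_compat_r; lra. }
      assert (B1 : 0 <= al * (x - x1)) by (apply Rmult_le_pos; lra).
      assert (B2 : (al + / N) * (x - x1) <= x - x1) by nra.
      assert (B3 : 0 <= al * t) by (apply Rmult_le_pos; lra).
      assert (B4 : (al + / N) * t <= t) by nra.
      assert (Hstep := Hd (x1 + al * (x - x1)) (al * t)
        (x1 + (al + / N) * (x - x1)) ((al + / N) * t)
        ltac:(lra) ltac:(lra) ltac:(lra) ltac:(lra)).
      simpl in Hstep. rewrite !(Rabs_pos_eq (_ * t)) in Hstep by lra.
      match type of Hstep with _ -> _ -> Rabs (?X - ?Y) < 1 =>
        assert (Rabs X <= Rabs Y + 1) end; [|lra].
      match goal with |- Rabs ?X <= Rabs ?Y + 1 =>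
        assert (Rabs (X - Y) < 1);
        [|pose proof (Rabs_triang_inv X Y); lra] end.
      apply Hstep.
      + match goal with |- Rabs ?X < _ => replace X with (/ N * (x - x1)) by ring end.
        rewrite Rabs_pos_eq; lra.
      + match goal with |- Rabs ?X < _ => replace X with (/ N * t) by ring end.
        rewrite Rabs_pos_eq; lra. }
  specialize (Hwalk (S n)). rewrite S_INR in Hwalk. fold N in Hwalk.
  specialize (Hwalk ltac:(lra)). replace (N / N) with 1 in Hwalk by (field; lra).
  rewrite !Rmult_1_l in Hwalk. replace (x1 + (x - x1)) with x in Hwalk by ring. exact Hwalk.
Qed.

Lemma is_derive_along_line (h hx ht : R -> R -> R) (T y k t : R) :
  cont_strip T hx ->
  (forall x s, 0 < s < T -> is_derive (fun z => h z s) x (hx x s)) ->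
  (forall x s, 0 < s < T -> is_derive (h x) s (ht x s)) ->
  0 < t < T ->
  is_derive (fun s => h (y + k * s) s) t (k * hx (y + k * t) t + ht (y + k * t) t).
Proof.
  intros Chx Dx Dt Ht.
  assert (HF := is_derive_filterdiff h (y + k * t) t hx (ht (y + k * t) t)).
  unfold is_derive.
  eapply filterdiff_ext_lin.
  - apply (filterdiff_comp'_2 (fun s => y + k * s) (fun s => s) h t (fun s => scal s k)
             (fun s => s)
             (fun a b => plus (scal a (hx (y + k * t) t)) (scal b (ht (y + k * t) t)))).
    + assert (HL : is_derive (fun s => y + k * s) t k) by (auto_derive; [exact I|ring]).
      exact HL.
    + apply filterdiff_id.
    + apply HF.
      * apply (proj1 (locally_2d_locally
          (fun v s => is_derive (fun z => h z s) v (hx v s)) _ _)).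
        apply (locally_2d_interior T); [assumption|].
        intros x s Hs. now apply Dx.
      * now apply Dt.
      * apply continuity_2d_pt_filterlim. now apply (cont_strip_interior T).
  - intros s. simpl. unfold scal, plus; simpl. unfold mult; simpl. ring.
Qed.

(** * Finite propagation speed *)

(** Superlinearity makes the nonlinearity Lipschitz at [0] for bounded [u_x]; this
    is where [p > 1] enters the finite propagation speed. *)
Lemma abs_pow_le_mult (y p M : R) :
  1 < p -> 0 < M -> Rabs y <= M -> abs_pow y p <= Rpower M (p - 1) * Rabs y.
Proof.
  intros hp HM Hy. unfold abs_pow. destruct (Req_EM_T y 0) as [->|Hn].
  - rewrite Rabs_R0. lra.
  - assert (Hpos : 0 < Rabs y) by now apply Rabs_pos_lt.
    replace p with (p - 1 + 1) at 1 by ring.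
    rewrite Rpower_plus, Rpower_1 by assumption.
    apply Rmult_le_compat_r; [lra|]. apply Rle_Rpower_l; lra.
Qed.

Lemma abs_pow_nonneg (y p : R) : 0 <= abs_pow y p.
Proof.
  unfold abs_pow. destruct (Req_EM_T y 0); [lra|apply Rlt_le, Rpower_pos].
Qed.

Lemma japanese_ge1 (x : R) : 1 <= japanese x.
Proof.
  unfold japanese. rewrite <- sqrt_1 at 1. apply sqrt_le_1_alt.
  pose proof (pow2_ge_0 x). lra.
Qed.

Lemma Rpower_japanese_inv_le (a x M : R) :
  0 <= M -> Rabs x <= M -> / Rpower (japanese x) a <= Rpower (1 + M) (Rabs a).
Proof.
  intros HM Hx. pose proof (japanese_ge1 x) as Hj.
  rewrite <- Rpower_Ropp.
  apply Rle_trans with (Rpower (japanese x) (Rabs a)).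
  - apply Rle_Rpower; [assumption|]. rewrite <- Rabs_Ropp. apply Rle_abs.
  - apply Rle_Rpower_l; [apply Rabs_pos|]. split; [lra|].
    unfold japanese. rewrite <- (sqrt_pow2 (1 + M)) by lra. apply sqrt_le_1_alt.
    assert (x ^ 2 <= M ^ 2); [|nra].
    rewrite <- (pow2_abs x). apply pow_incr. split; [apply Rabs_pos|assumption].
Qed.

Lemma derive_zero_outside (h : R -> R) (r x l : R) :
  (forall y, r < Rabs y -> h y = 0) -> r < Rabs x -> is_derive h x l -> l = 0.
Proof.
  intros Hz Hx Hd. rewrite <- (is_derive_unique _ _ _ Hd).
  apply is_derive_unique. apply is_derive_ext_loc with (fun _ => 0).
  2: apply (is_derive_const (K := R_AbsRing) (V := R_NormedModule)).
  assert (Hpos : 0 < Rabs x - r) by lra.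
  exists (mkposreal _ Hpos). intros z Hzz. change (Rabs (z - x) < Rabs x - r) in Hzz.
  symmetry. apply Hz.
  pose proof (Rabs_triang_inv x z). rewrite (Rabs_minus_sym x z) in H. lra.
Qed.

Section FiniteSpeed.
Variables (p a T : R) (u0 u1 : R -> R) (u ux ut uxx uxt utt : R -> R -> R).
Hypotheses (hp : 1 < p) (hu : regular_solution p a u0 u1 T u ux ut uxx uxt utt).

Let N := fun x t => utt x t - uxx x t.

(** The mixed derivatives cancel along the characteristic of slope [- sg], and
    [sg^2 = 1] leaves the wave operator. *)
Lemma is_derive_riemann_invariant (sg y t : R) :
  sg * sg = 1 -> 0 < t < T ->
  is_derive (fun s => ut (y + - sg * s) s + sg * ux (y + - sg * s) s) t
    (N (y + - sg * t) t).
Proof.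
  intros Hsg Ht. evar_last.
  - apply (is_derive_plus (fun s => ut (y + - sg * s) s)
             (fun s => sg * ux (y + - sg * s) s)).
    + apply (is_derive_along_line ut uxt utt T); try apply hu. assumption.
    + apply (is_derive_scal (fun s => ux (y + - sg * s) s)).
      apply (is_derive_along_line ux uxx uxt T); try apply hu; [|assumption].
      intros x s Hs. apply hu. lra.
  - unfold plus; simpl. unfold N.
    match goal with |- ?L = ?Rr =>
      replace L with (utt (y + - sg * t) t - sg * sg * uxx (y + - sg * t) t) by ring end.
    rewrite Hsg. ring.
Qed.

Lemma continuity_pt_along_line (h : R -> R -> R) (y k t : R) :
  cont_strip T h -> 0 <= t < T ->
  continuity_pt (fun s => h (y + k * s) (Rabs s)) t.
Proof.
  intros H Ht.
  assert (HC := H (y + k * t) t ltac:(rewrite Rabs_pos_eq; lra)).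
  intros e He. destruct (HC (mkposreal e He)) as [d Hd].
  pose proof (cond_pos d) as Hd0. pose proof (Rabs_pos k) as Hk.
  exists (d / (1 + Rabs k)). split; [apply Rdiv_lt_0_compat; lra|].
  intros s [_ Hs]. simpl in Hs. unfold Rdist in Hs. apply Rlt_div_r in Hs; [|lra].
  pose proof (Rabs_pos (s - t)).
  apply (Hd (y + k * s) s).
  - replace (y + k * s - (y + k * t)) with (k * (s - t)) by ring.
    rewrite Rabs_mult. nra.
  - nra.
Qed.

(** Gronwall iteration for both invariants at once.  If they are bounded by
    [b e^(2Kt)] in the cone, so is [u_x], half their difference; integrating the
    source, at most [K |u_x|], along a characteristic, which stays in the cone,
    improves the bound by the factor [K / (2K) = 1/2]. *)
Lemma zero_in_cone (x0 t0 : R) :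
  0 <= t0 < T ->
  (forall y, Rabs (y - x0) <= t0 -> ux y 0 = 0 /\ ut y 0 = 0) ->
  forall x t, 0 <= t <= t0 -> Rabs (x - x0) <= t0 - t -> ux x t = 0 /\ ut x t = 0.
Proof.
  intros Ht0 H0.
  destruct (cont_strip_bounded T ux (x0 - t0) (x0 + t0) t0) as [M1 [HM1 B1]];
    [apply hu|lra|lra|].
  destruct (cont_strip_bounded T ut (x0 - t0) (x0 + t0) t0) as [M2 [HM2 B2]];
    [apply hu|lra|lra|].
  set (K := Rpower M1 (p - 1) * Rpower (1 + (Rabs x0 + t0)) (Rabs a)).
  assert (HK : 0 < K) by (apply Rmult_lt_0_compat; apply Rpower_pos).
  assert (HN : forall x t, 0 < t <= t0 -> Rabs (x - x0) <= t0 - t ->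
            Rabs (N x t) <= K * Rabs (ux x t)).
  { intros x t Ht Hx. unfold N. rewrite (rs_eq _ _ _ _ _ _ _ _ _ _ _ hu) by lra.
    apply Rabs_le_between in Hx as Hx'.
    pose proof (abs_pow_nonneg (ux x t) p).
    pose proof (Rpower_pos (japanese x) a) as Hj.
    rewrite Rabs_pos_eq.
    2: apply Rdiv_le_0_compat; assumption.
    apply Rle_trans with (Rpower M1 (p - 1) * Rabs (ux x t) * Rpower (1 + (Rabs x0 + t0)) (Rabs a)).
    - apply Rmult_le_compat; [assumption|apply Rlt_le, Rinv_0_lt_compat, Hj| |].
      + apply abs_pow_le_mult; try assumption. apply B1; lra.
      + apply Rpower_japanese_inv_le; [pose proof (Rabs_pos x0); lra|].
        pose proof (Rabs_triang_inv x x0). lra.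
    - apply Req_le. unfold K. ring. }
  set (W := fun sg x t => ut x t + sg * ux x t).
  set (M := M1 + M2).
  assert (Hind : forall n sg x t, sg * sg = 1 -> 0 <= t <= t0 -> Rabs (x - x0) <= t0 - t ->
     Rabs (W sg x t) <= M * (/ 2) ^ n * exp (2 * K * t)).
  { induction n as [|n IH]; intros sg x t Hsg Ht Hx.
    - apply Rabs_le_between in Hx as Hx'.
      assert (HE : 1 <= exp (2 * K * t)).
      { pose proof (exp_ineq1_le (2 * K * t)). assert (0 <= 2 * K * t); [|lra].
        apply Rmult_le_pos; lra. }
      assert (Hs1 : Rabs sg = 1).
      { pose proof (Rabs_pos sg). assert (Rabs sg * Rabs sg = 1); [|nra].
        rewrite <- Rabs_mult, Hsg. apply Rabs_R1. }
      assert (Rabs (W sg x t) <= M).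
      { unfold W, M. eapply Rle_trans; [apply Rabs_triang|].
        rewrite Rabs_mult, Hs1.
        pose proof (B1 x t ltac:(lra) ltac:(lra)). pose proof (B2 x t ltac:(lra) ltac:(lra)). lra. }
      simpl. assert (0 < M) by (unfold M; lra). nra.
    - set (y := x + sg * t).
      set (b := M * (/ 2) ^ n) in *.
      assert (Hs1 : -1 <= sg <= 1) by nra.
      assert (Hcone : forall s, 0 <= s <= t -> Rabs (y + - sg * s - x0) <= t0 - s).
      { intros s Hs. replace (y + - sg * s - x0) with ((x - x0) + sg * (t - s)) by (unfold y; ring).
        eapply Rle_trans; [apply Rabs_triang|].
        assert (Rabs (sg * (t - s)) <= t - s); [|lra].
        apply Rabs_le_between. nra. }
      assert (Hux : forall s, 0 <= s <= t -> Rabs (ux (y + - sg * s) s) <= b * exp (2 * K * s)).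
      { intros s Hs.
        pose proof (IH 1 (y + - sg * s) s ltac:(ring) ltac:(lra) (Hcone s Hs)) as I1.
        pose proof (IH (-1) (y + - sg * s) s ltac:(ring) ltac:(lra) (Hcone s Hs)) as I2.
        unfold W in I1, I2. apply Rabs_le_between in I1, I2. apply Rabs_le_between. lra. }
      (* The two signs [rho] give the two sides of the bound on the invariant. *)
      assert (Hmono : forall rho, rho * rho = 1 ->
        b / 2 * exp (2 * K * 0) - rho * W sg y 0 <=
        b / 2 * exp (2 * K * t) - rho * W sg x t).
      { intros rho Hrho.
        assert (Hr1 : -1 <= rho <= 1) by nra.
        assert (HG := derive_nonneg_le
          (fun s => b / 2 * exp (2 * K * s) -
             rho * (ut (y + - sg * s) (Rabs s) + sg * ux (y + - sg * s) (Rabs s)))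
          (fun s => b * K * exp (2 * K * s) - rho * N (y + - sg * s) s) 0 t).
        cbv beta in HG. rewrite Rabs_R0, (Rabs_pos_eq t) in HG by lra.
        unfold W. replace (y + - sg * 0) with y in HG by ring.
        replace (y + - sg * t) with x in HG by (unfold y; ring).
        apply HG; [lra| | |].
        - intros s Hs.
          apply is_derive_ext_loc with (fun s => b / 2 * exp (2 * K * s) -
             rho * (ut (y + - sg * s) s + sg * ux (y + - sg * s) s)).
          { apply (locally_interior (t + s)); [lra|]. intros r Hr.
            rewrite (Rabs_pos_eq r) by lra. reflexivity. }
          apply (is_derive_minus (fun s => b / 2 * exp (2 * K * s))
             (fun s => rho * (ut (y + - sg * s) s + sg * ux (y + - sg * s) s))).
          + auto_derive; [exact I|]. field.
          + apply (is_derive_scal (fun s => ut (y + - sg * s) s + sg * ux (y + - sg * s) s)).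
            apply is_derive_riemann_invariant; [assumption|lra].
        - intros s Hs.
          apply (continuity_pt_minus (fun s => b / 2 * exp (2 * K * s))
             (fun s => rho * (ut (y + - sg * s) (Rabs s) + sg * ux (y + - sg * s) (Rabs s)))).
          + apply is_derive_continuity_pt with (b * K * exp (2 * K * s)).
            auto_derive; [exact I|]. field.
          + apply (continuity_pt_scal
              (fun s => ut (y + - sg * s) (Rabs s) + sg * ux (y + - sg * s) (Rabs s))).
            apply (continuity_pt_plus (fun s => ut (y + - sg * s) (Rabs s))
              (fun s => sg * ux (y + - sg * s) (Rabs s))).
            * apply continuity_pt_along_line; [apply hu|lra].
            * apply (continuity_pt_scal (fun s => ux (y + - sg * s) (Rabs s))).
              apply continuity_pt_along_line; [apply hu|lra].
        - intros s Hs.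
          pose proof (HN (y + - sg * s) s ltac:(lra) (Hcone s ltac:(lra))) as HNs.
          pose proof (Hux s ltac:(lra)) as Hus.
          assert (Rabs (N (y + - sg * s) s) <= b * K * exp (2 * K * s)) by nra.
          apply Rabs_le_between in H. nra. }
      assert (HW0 : W sg y 0 = 0).
      { unfold W. destruct (H0 y) as [-> ->]; [|ring].
        specialize (Hcone 0 ltac:(lra)). rewrite Rmult_0_r, Rplus_0_r in Hcone. lra. }
      assert (Hb : 0 <= b).
      { unfold b, M. apply Rmult_le_pos; [lra|]. apply pow_le. lra. }
      pose proof (Hmono 1 ltac:(ring)) as P1. pose proof (Hmono (-1) ltac:(ring)) as P2.
      rewrite HW0 in P1, P2. rewrite Rmult_0_r, exp_0 in P1, P2.
      replace (M * (/ 2) ^ S n * exp (2 * K * t)) with (b / 2 * exp (2 * K * t))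
        by (unfold b; simpl; field).
      apply Rabs_le_between. lra. }
  assert (HW : forall sg x t, sg * sg = 1 -> 0 <= t <= t0 -> Rabs (x - x0) <= t0 - t -> W sg x t = 0).
  { intros sg x t Hsg Ht Hx.
    destruct (Req_dec (W sg x t) 0) as [|Hn]; [assumption|exfalso].
    assert (Hpos : 0 < Rabs (W sg x t)) by now apply Rabs_pos_lt.
    assert (HE := exp_pos (2 * K * t)).
    assert (HC : 0 < M * exp (2 * K * t)) by (apply Rmult_lt_0_compat; [unfold M; lra|assumption]).
    destruct (pow_lt_1_zero (/ 2)) with (y := Rabs (W sg x t) / (M * exp (2 * K * t)))
      as [n Hn'].
    { rewrite Rabs_pos_eq; lra. }
    { now apply Rdiv_lt_0_compat. }
    specialize (Hn' n (le_n n)). rewrite Rabs_pos_eq in Hn' by (apply pow_le; lra).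
    apply Rlt_div_r in Hn'; [|assumption].
    specialize (Hind n sg x t Hsg Ht Hx). nra. }
  intros x t Ht Hx.
  pose proof (HW 1 x t ltac:(ring) Ht Hx) as W1. pose proof (HW (-1) x t ltac:(ring) Ht Hx) as W2.
  unfold W in W1, W2. lra.
Qed.

(** The base of the backward cone with vertex [(x, t)] lies outside the support of
    the data, and [u_t = 0] on its axis. *)
Lemma finite_speed (r : R) :
  (forall x, r < Rabs x -> u0 x = 0 /\ u1 x = 0) ->
  forall x t, 0 <= t < T -> t + r < Rabs x -> u x t = 0 /\ ux x t = 0.
Proof.
  intros Hdata x0 t0 Ht0 Hx0.
  assert (Hux0 : forall y, r < Rabs y -> ux y 0 = 0).
  { intros y Hy. apply (derive_zero_outside (fun z => u z 0) r y); [|assumption|apply hu; lra].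
    intros z Hz. rewrite (rs_u0 _ _ _ _ _ _ _ _ _ _ _ hu). now apply Hdata. }
  assert (Hcone := zero_in_cone x0 t0 Ht0).
  assert (Hbase : forall y, Rabs (y - x0) <= t0 -> r < Rabs y).
  { intros y Hy. pose proof (Rabs_triang_inv x0 y). rewrite (Rabs_minus_sym x0 y) in H. lra. }
  assert (Hz := Hcone ltac:(intros y Hy; split;
    [now apply Hux0, Hbase
    |rewrite (rs_u1 _ _ _ _ _ _ _ _ _ _ _ hu); apply Hdata, Hbase, Hy])).
  assert (Hxx : Rabs (x0 - x0) = 0) by (rewrite Rminus_eq_0; apply Rabs_R0).
  split; [|apply Hz; lra].
  (* [u] is constant on the vertical segment below the vertex of the cone. *)
  assert (Hcst : forall rho, rho * u x0 0 <= rho * u x0 t0).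
  { intros rho.
    assert (HG := derive_nonneg_le (fun s => rho * u x0 (Rabs s)) (fun s => rho * ut x0 s) 0 t0).
    cbv beta in HG. rewrite Rabs_R0, (Rabs_pos_eq t0) in HG by lra.
    apply HG; [lra| | |].
    - intros s Hs. apply (is_derive_scal (fun s => u x0 (Rabs s))).
      apply is_derive_ext_loc with (u x0); [|apply hu; lra].
      apply (locally_interior T); [lra|]. intros z Hz'. rewrite Rabs_pos_eq; [reflexivity|lra].
    - intros s Hs. apply (continuity_pt_scal (fun s => u x0 (Rabs s))).
      apply (cont_strip_t T); [apply hu|lra].
    - intros s Hs. destruct (Hz x0 s) as [_ ->]; lra. }
  assert (Hu00 : u x0 0 = 0).
  { rewrite (rs_u0 _ _ _ _ _ _ _ _ _ _ _ hu). apply Hdata, Hbase. lra. }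
  pose proof (Hcst 1). pose proof (Hcst (-1)). rewrite Hu00 in *. lra.
Qed.
End FiniteSpeed.

(** * Inequalities for powers *)

Lemma Rpower_bernoulli (p z : R) : 1 < p -> 0 < z -> p * z - (p - 1) <= Rpower z p.
Proof.
  intros hp hz.
  destruct (Rle_lt_dec (p * z - (p - 1)) 0) as [|HA].
  { pose proof (Rpower_pos z p). lra. }
  set (A := p * z - (p - 1)) in *.
  unfold Rpower. rewrite <- (exp_ln A HA).
  assert (Hln : ln A <= p * ln z).
  (* Weighted arithmetic-geometric mean: [z] is the mean of [A] and [1] with
     weights [1/p] and [1 - 1/p]. *)
  { assert (H1 : ln (A / z) <= A / z - 1).
    { pose proof (exp_ineq1_le (ln (A / z))) as He.
      rewrite exp_ln in He by (apply Rdiv_lt_0_compat; lra). lra. }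
    assert (H2 : - ln z <= / z - 1).
    { pose proof (exp_ineq1_le (- ln z)) as He. rewrite exp_Ropp, exp_ln in He by lra. lra. }
    rewrite ln_div in H1 by lra.
    assert (H3 : A / z + (p - 1) * / z = p) by (unfold A; field; lra).
    assert ((p - 1) * - ln z <= (p - 1) * (/ z - 1)) by (apply Rmult_le_compat_l; lra).
    lra. }
  destruct Hln as [Hlt|Heq]; [apply Rlt_le, exp_increasing, Hlt|rewrite Heq; lra].
Qed.

(** Convexity: the right-hand side lies above its tangent at [l].  Used with a
    weight-dependent [l], it replaces Hölder's inequality. *)
Lemma abs_pow_tangent (y l p : R) :
  1 < p -> 0 < l ->
  p * Rpower l (p - 1) * Rabs y - (p - 1) * Rpower l p <= abs_pow y p.
Proof.
  intros hp hl. unfold abs_pow. destruct (Req_EM_T y 0) as [->|Hn].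
  - rewrite Rabs_R0. pose proof (Rpower_pos l p). nra.
  - assert (Hy : 0 < Rabs y) by now apply Rabs_pos_lt.
    set (z := Rabs y / l).
    assert (Hz : 0 < z) by now apply Rdiv_lt_0_compat.
    assert (Hyz : Rabs y = l * z) by (unfold z; field; lra).
    rewrite Hyz, <- Rpower_mult_distr by assumption.
    replace (p * Rpower l (p - 1) * (l * z)) with (Rpower l p * (p * z)).
    2: { replace p with (p - 1 + 1) at 1 by ring.
         rewrite Rpower_plus, Rpower_1 by assumption. ring. }
    pose proof (Rpower_bernoulli p z hp Hz). pose proof (Rpower_pos l p). nra.
Qed.

Lemma Rpower_comparable (X Y k s : R) :
  0 < X -> 0 < Y -> 1 <= k -> X <= k * Y -> Y <= k * X ->
  Rpower k (- Rabs s) * Rpower Y s <= Rpower X s.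
Proof.
  intros hX hY hk H1 H2. destruct (Rle_lt_dec 0 s) as [Hs|Hs].
  - rewrite Rabs_pos_eq by assumption.
    apply Rmult_le_reg_l with (Rpower k s); [apply Rpower_pos|].
    rewrite <- Rmult_assoc, <- Rpower_plus, Rplus_opp_r, Rpower_O, Rmult_1_l by lra.
    rewrite Rpower_mult_distr by lra. apply Rle_Rpower_l; lra.
  - rewrite Rabs_left, Ropp_involutive by assumption.
    rewrite Rpower_mult_distr by lra.
    replace s with (- - s) by ring. rewrite !(Rpower_Ropp _ (- s)).
    apply Rinv_le_contravar; [apply Rpower_pos|]. apply Rle_Rpower_l; lra.
Qed.

(** * Integration against hyperbolic weights *)

Definition cosh2 (x : R) : R := exp x + exp (- x).
Definition sinh2 (x : R) : R := exp x - exp (- x).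

Lemma cosh2_pos (x : R) : 0 < cosh2 x.
Proof. unfold cosh2. pose proof (exp_pos x). pose proof (exp_pos (- x)). lra. Qed.

Lemma Rabs_sinh2_le (x : R) : Rabs (sinh2 x) <= cosh2 x.
Proof.
  unfold sinh2, cosh2. pose proof (exp_pos x). pose proof (exp_pos (- x)).
  apply Rabs_le_between. lra.
Qed.

Lemma is_derive_cosh2 (x : R) : is_derive cosh2 x (sinh2 x).
Proof. unfold cosh2, sinh2. auto_derive; [exact I|ring]. Qed.

Lemma is_derive_sinh2 (x : R) : is_derive sinh2 x (cosh2 x).
Proof. unfold cosh2, sinh2. auto_derive; [exact I|ring]. Qed.

Lemma is_derive_continuous (F : R -> R) (x l : R) : is_derive F x l -> continuous F x.
Proof. intros H. apply (ex_derive_continuous (V := R_NormedModule)). now exists l. Qed.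

Lemma continuous_cosh2 (x : R) : continuous cosh2 x.
Proof. eapply is_derive_continuous, is_derive_cosh2. Qed.

Lemma continuous_sinh2 (x : R) : continuous sinh2 x.
Proof. eapply is_derive_continuous, is_derive_sinh2. Qed.

Lemma continuous_mult_R (f g : R -> R) (x : R) :
  continuous f x -> continuous g x -> continuous (fun y => f y * g y) x.
Proof. intros; now apply (continuous_mult (K := R_AbsRing) f g). Qed.

Lemma ex_RInt_cont (h : R -> R) (a b : R) : (forall x, continuous h x) -> ex_RInt h a b.
Proof. intros H. apply (ex_RInt_continuous (V := R_CompleteNormedModule)). intros; apply H. Qed.

Lemma RInt_by_parts (f df g dg : R -> R) (a b : R) :
  (forall x, is_derive f x (df x)) -> (forall x, is_derive g x (dg x)) ->
  (forall x, continuous df x) -> (forall x, continuous dg x) ->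
  f a = 0 -> f b = 0 ->
  RInt (fun x => df x * g x) a b = - RInt (fun x => f x * dg x) a b.
Proof.
  intros Df Dg Cdf Cdg Ha Hb.
  assert (Cf : forall x, continuous f x) by (intros x; eapply is_derive_continuous, Df).
  assert (Cg : forall x, continuous g x) by (intros x; eapply is_derive_continuous, Dg).
  assert (C1 : forall x, continuous (fun x => df x * g x) x)
    by (intros x; now apply continuous_mult_R).
  assert (C2 : forall x, continuous (fun x => f x * dg x) x)
    by (intros x; now apply continuous_mult_R).
  assert (H : is_RInt (fun x => df x * g x + f x * dg x) a b (f b * g b - f a * g a)).
  { apply (is_RInt_derive (fun x => f x * g x)).
    - intros x _. apply (is_derive_mult f g); [apply Df|apply Dg|intros; apply Rmult_comm].
    - intros x _. apply (continuous_plus (V := R_NormedModule)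
        (fun x => df x * g x) (fun x => f x * dg x)); auto. }
  apply (is_RInt_unique (V := R_CompleteNormedModule)) in H.
  rewrite (RInt_plus (V := R_CompleteNormedModule) (fun x => df x * g x) (fun x => f x * dg x)) in H
    by now apply ex_RInt_cont.
  unfold plus in H; simpl in H. rewrite Ha, Hb in H. lra.
Qed.

Lemma RInt_restrict (h : R -> R) (S L : R) :
  (forall x, continuous h x) -> 0 <= S <= L -> (forall x, S < Rabs x -> h x = 0) ->
  RInt h (- L) L = RInt h (- S) S.
Proof.
  intros C HS Hz.
  rewrite <- (RInt_Chasles (V := R_CompleteNormedModule) h (- L) (- S) L) by now apply ex_RInt_cont.
  rewrite <- (RInt_Chasles (V := R_CompleteNormedModule) h (- S) S L) by now apply ex_RInt_cont.
  assert (Z : forall a b, a <= b -> (forall x, a < x < b -> S < Rabs x) -> RInt h a b = 0).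
  { intros a b Hab Hx.
    rewrite (RInt_ext (V := R_CompleteNormedModule) h (fun _ => 0)).
    - rewrite (RInt_const (V := R_CompleteNormedModule)). unfold scal; simpl; unfold mult; simpl. ring.
    - rewrite Rmin_left, Rmax_right by assumption. intros x Hxx. now apply Hz, Hx. }
  rewrite (Z (- L) (- S)), (Z S L).
  - unfold plus; simpl. ring.
  - lra.
  - intros x Hx. rewrite Rabs_pos_eq; lra.
  - lra.
  - intros x Hx. rewrite Rabs_left; lra.
Qed.

(** The improper integral is eventually constant in its bounds. *)
Lemma integral_R_supported (h : R -> R) (r L : R) :
  (forall x, continuous h x) -> 0 <= r <= L -> (forall x, r < Rabs x -> h x = 0) ->
  integral_R h = RInt h (- L) L.
Proof.
  intros C HL Hz. unfold integral_R.
  apply (is_RInt_gen_unique (V := R_CompleteNormedModule)).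
  rewrite (RInt_restrict h r L) by assumption.
  intros P HP.
  exists (fun x => x < - r) (fun x => r < x).
  - exists (- r). intros x Hx; exact Hx.
  - exists r. intros x Hx; exact Hx.
  - intros x y Hx Hy. exists (RInt h (- r) r). split; [|now apply locally_singleton].
    simpl.
    set (M := Rmax (- x) y).
    assert (HM1 : - x <= M) by apply Rmax_l. assert (HM2 : y <= M) by apply Rmax_r.
    rewrite <- (RInt_restrict h r M) by (try assumption; lra).
    assert (Z : forall a b, a <= b -> (forall x, a < x < b -> r < Rabs x) -> is_RInt h a b 0).
    { intros a b Hab Hxx.
      apply (is_RInt_ext (V := R_NormedModule) (fun _ => 0)).
      - rewrite Rmin_left, Rmax_right by assumption. intros z Hz'. symmetry. now apply Hz, Hxx.
      - evar_last; [apply (is_RInt_const (V := R_NormedModule))|].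
        unfold scal; simpl; unfold mult; simpl. ring. }
    replace (RInt h (- M) M) with (plus (plus 0 (RInt h (- M) M)) 0)
      by (unfold plus; simpl; ring).
    apply (is_RInt_Chasles (V := R_NormedModule) h x M y).
    + apply (is_RInt_Chasles (V := R_NormedModule) h x (- M) M).
      * replace 0 with (opp 0) by (unfold opp; simpl; ring).
        apply (is_RInt_swap (V := R_NormedModule)). apply Z; [lra|].
        intros z Hzz. rewrite Rabs_left; lra.
      * apply (RInt_correct (V := R_CompleteNormedModule)). now apply ex_RInt_cont.
    + replace 0 with (opp 0) by (unfold opp; simpl; ring).
      apply (is_RInt_swap (V := R_NormedModule)). apply Z; [lra|].
      intros z Hzz. rewrite Rabs_pos_eq; lra.
Qed.

(** * The weighted Hölder inequality *)

(** The bracket [<x>] is traded for [V x = x^2 + A^2] to the power [1/2], which is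
    comparable to it.  Taking [A >= |b|] makes the logarithmic derivative of
    [V^(b/2)] at most [1/2], so that the weight [cosh2 V^(b/2)] is dominated by the
    derivative of [2 sinh2 V^(b/2)] and its integral over [[-S, S]] is at most
    [4 e^S (V S)^(b/2)], for either sign of [b]. *)
Section Holder.
Variables (p a A : R).
Hypotheses (hp : 1 < p) (hA : 1 <= A) (hbA : Rabs (a / (p - 1)) <= A).
Let b := a / (p - 1).
Let V := fun x => x ^ 2 + A ^ 2.

Lemma holder_V_pos (x : R) : 0 < V x.
Proof. unfold V. pose proof (pow2_ge_0 x). nra. Qed.

Definition cosh_weight_constant : R := Rpower (A ^ 2) (- Rabs (- a / 2)).

Lemma japanese_weight_lower (x : R) :
  cosh_weight_constant * Rpower (V x) (- a / 2) <= / Rpower (japanese x) a.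
Proof.
  pose proof (pow2_ge_0 x) as Hx. pose proof (holder_V_pos x) as HV.
  replace (/ Rpower (japanese x) a) with (Rpower (1 + x ^ 2) (- a / 2)).
  - assert (1 <= A ^ 2) by nra.
    apply Rpower_comparable; unfold V in *; nra.
  - unfold japanese. rewrite <- Rpower_sqrt, Rpower_mult, <- Rpower_Ropp by lra.
    f_equal. field.
Qed.

Lemma cosh_weight_primitive (x : R) :
  exists d, is_derive (fun y => 2 * (sinh2 y * Rpower (V y) (b / 2))) x d /\
    cosh2 x * Rpower (V x) (b / 2) <= d.
Proof.
  pose proof (holder_V_pos x) as HV. pose proof (Rpower_pos (V x) (b / 2)) as HP.
  exists (2 * (Rpower (V x) (b / 2) * (cosh2 x + sinh2 x * (b * x / V x)))).
  split.
  - evar_last.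
    + apply (is_derive_scal (fun y => sinh2 y * Rpower (V y) (b / 2))).
      apply (is_derive_mult sinh2 (fun y => Rpower (V y) (b / 2))).
      * apply is_derive_sinh2.
      * apply is_derive_Rpower_comp; [assumption|]. unfold V. auto_derive; [exact I|reflexivity].
      * intros; apply Rmult_comm.
    + unfold plus, mult; simpl.
      replace (Rpower (V x) (b / 2 - 1)) with (Rpower (V x) (b / 2) / V x).
      2: { unfold Rminus. rewrite Rpower_plus, (Rpower_Ropp _ 1), Rpower_1 by assumption.
           reflexivity. }
      field. lra.
  - assert (Hr : Rabs (b * x / V x) <= / 2).
    { unfold Rdiv. rewrite Rabs_mult, (Rabs_pos_eq (/ V x)).
      2: now apply Rlt_le, Rinv_0_lt_compat.
      apply Rle_div_l; [assumption|]. rewrite Rabs_mult.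
      assert (Rabs b * Rabs x <= A * Rabs x)
        by (apply Rmult_le_compat_r; [apply Rabs_pos|assumption]).
      unfold V. rewrite <- (pow2_abs x). pose proof (pow2_ge_0 (Rabs x - A)). nra. }
    assert (Hs : Rabs (sinh2 x * (b * x / V x)) <= cosh2 x * / 2).
    { rewrite Rabs_mult. apply Rmult_le_compat; try apply Rabs_pos; [apply Rabs_sinh2_le|assumption]. }
    apply Rabs_le_between in Hs. nra.
Qed.

Lemma cosh_weight_integral (S : R) :
  0 <= S ->
  RInt (fun x => cosh2 x * Rpower (V x) (b / 2)) (- S) S <= 4 * (exp S * Rpower (V S) (b / 2)).
Proof.
  intros HS.
  set (P := fun y => 2 * (sinh2 y * Rpower (V y) (b / 2))).
  assert (HC : forall x, continuous (fun x => cosh2 x * Rpower (V x) (b / 2)) x).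
  { intros x. apply continuous_mult_R; [apply continuous_cosh2|].
    apply (is_derive_continuous (fun x => Rpower (V x) (b / 2)) x
      (2 * x * (b / 2 * Rpower (V x) (b / 2 - 1)))).
    apply is_derive_Rpower_comp; [apply holder_V_pos|]. unfold V. auto_derive; [exact I|ring]. }
  assert (Hmono : P (- S) - RInt (fun x => cosh2 x * Rpower (V x) (b / 2)) (- S) (- S)
            <= P S - RInt (fun x => cosh2 x * Rpower (V x) (b / 2)) (- S) S).
  { assert (HD : forall x, is_derive
        (fun y => P y - RInt (fun x => cosh2 x * Rpower (V x) (b / 2)) (- S) y) x
        (Derive P x - cosh2 x * Rpower (V x) (b / 2))).
    { intros x. apply (is_derive_minus P (fun y => RInt (fun x => cosh2 x * Rpower (V x) (b / 2)) (- S) y)).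
      - apply Derive_correct. destruct (cosh_weight_primitive x) as [d [Hd _]]. now exists d.
      - apply (is_derive_RInt (V := R_CompleteNormedModule)
          (fun x => cosh2 x * Rpower (V x) (b / 2)) _ (- S)); [|apply HC].
        apply filter_forall. intros y. apply (RInt_correct (V := R_CompleteNormedModule)).
        now apply ex_RInt_cont. }
    apply (derive_nonneg_le (fun y => P y - RInt (fun x => cosh2 x * Rpower (V x) (b / 2)) (- S) y)
       (fun x => Derive P x - cosh2 x * Rpower (V x) (b / 2))); [lra| | |].
    - intros x _. apply HD.
    - intros x _. eapply is_derive_continuity_pt, HD.
    - intros x _. destruct (cosh_weight_primitive x) as [d [Hd Hle]].
      apply is_derive_unique in Hd.
      replace (Derive P x) with d by (symmetry; exact Hd). lra. }
  rewrite (RInt_point (V := R_CompleteNormedModule)) in Hmono. unfold zero in Hmono; simpl in Hmono.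
  assert (HVS : V (- S) = V S) by (unfold V; ring).
  unfold P in Hmono. rewrite HVS in Hmono. unfold sinh2 in Hmono. rewrite Ropp_involutive in Hmono.
  pose proof (exp_pos (- S)). pose proof (Rpower_pos (V S) (b / 2)). nra.
Qed.

(** Apply [abs_pow_tangent] at [l = la V^(b/2)]: with [b = a / (p-1)] the weight
    [V^(-a/2)] cancels in the linear term and becomes [V^(b/2)] in the constant
    term.  Integration gives [p la^(p-1) F - (p-1) la^p W], which [la = F / W]
    maximizes, with value [F^p W^(1-p)]. *)
Lemma holder_cosh (S : R) (v n : R -> R) :
  0 <= S ->
  (forall x, continuous v x) -> (forall x, continuous n x) ->
  (forall x, Rabs x <= S -> abs_pow (v x) p / Rpower (japanese x) a <= n x) ->
  let F := - RInt (fun x => v x * sinh2 x) (- S) S in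
  0 < F ->
  cosh_weight_constant * (Rpower F p * Rpower (4 * (exp S * Rpower (V S) (b / 2))) (1 - p))
  <= RInt (fun x => n x * cosh2 x) (- S) S.
Proof.
  intros HS Cv Cn Hn F HF.
  set (W := 4 * (exp S * Rpower (V S) (b / 2))).
  assert (HW : 0 < W).
  { unfold W. apply Rmult_lt_0_compat; [lra|]. apply Rmult_lt_0_compat; [apply exp_pos|apply Rpower_pos]. }
  set (la := F / W).
  assert (Hla : 0 < la) by now apply Rdiv_lt_0_compat.
  assert (HcA : 0 < cosh_weight_constant) by apply Rpower_pos.
  set (k1 := cosh_weight_constant * (p * Rpower la (p - 1))).
  set (k2 := cosh_weight_constant * ((p - 1) * Rpower la p)).
  set (wt := fun x => cosh2 x * Rpower (V x) (b / 2)).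
  assert (Cwt : forall x, continuous wt x).
  { intros x. apply continuous_mult_R; [apply continuous_cosh2|].
    apply (is_derive_continuous (fun x => Rpower (V x) (b / 2)) x
      (2 * x * (b / 2 * Rpower (V x) (b / 2 - 1)))).
    apply is_derive_Rpower_comp; [apply holder_V_pos|]. unfold V. auto_derive; [exact I|ring]. }
  assert (Cvs : forall x, continuous (fun x => v x * sinh2 x) x).
  { intros x. apply continuous_mult_R; [apply Cv|apply continuous_sinh2]. }
  assert (Cnc : forall x, continuous (fun x => n x * cosh2 x) x).
  { intros x. apply continuous_mult_R; [apply Cn|apply continuous_cosh2]. }
  assert (Hpt : forall x, - S < x < S -> - k1 * (v x * sinh2 x) + - k2 * wt x <= n x * cosh2 x).
  { intros x Hx.
    pose proof (cosh2_pos x) as Hc. pose proof (holder_V_pos x) as HV.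
    assert (Hnx := Hn x ltac:(apply Rabs_le_between; lra)).
    assert (Hl : 0 < la * Rpower (V x) (b / 2)) by (apply Rmult_lt_0_compat; [assumption|apply Rpower_pos]).
    assert (Ht := abs_pow_tangent (v x) (la * Rpower (V x) (b / 2)) p hp Hl).
    rewrite <- !Rpower_mult_distr, !Rpower_mult in Ht by (assumption || apply Rpower_pos).
    set (wa := Rpower (V x) (- a / 2)) in *.
    assert (Hwa : 0 < wa) by apply Rpower_pos.
    assert (E1 : Rpower (V x) (b / 2 * (p - 1)) * wa = 1).
    { unfold wa. rewrite <- Rpower_plus.
      replace (b / 2 * (p - 1) + - a / 2) with 0 by (unfold b; field; lra). now apply Rpower_O. }
    assert (E2 : Rpower (V x) (b / 2 * p) * wa = Rpower (V x) (b / 2)).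
    { unfold wa. rewrite <- Rpower_plus. f_equal. unfold b; field; lra. }
    assert (Hw := japanese_weight_lower x). fold wa in Hw.
    assert (Hap := abs_pow_nonneg (v x) p).
    assert (G1 : cosh_weight_constant * (abs_pow (v x) p * wa) <= n x).
    { apply Rle_trans with (2 := Hnx). unfold Rdiv.
      replace (cosh_weight_constant * (abs_pow (v x) p * wa))
        with (abs_pow (v x) p * (cosh_weight_constant * wa)) by ring.
      now apply Rmult_le_compat_l. }
    assert (G2 : p * Rpower la (p - 1) * Rabs (v x) - (p - 1) * Rpower la p * Rpower (V x) (b / 2)
              <= abs_pow (v x) p * wa).
    { apply Rmult_le_compat_r with (r := wa) in Ht; [|lra].
      eapply Rle_trans; [|exact Ht]. apply Req_le.
      rewrite <- E2.
      transitivity (p * Rpower la (p - 1) * Rabs (v x) * (Rpower (V x) (b / 2 * (p - 1)) * wa)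
         - (p - 1) * Rpower la p * (Rpower (V x) (b / 2 * p) * wa)); [rewrite E1; ring|ring]. }
    assert (Hk1 : 0 <= k1).
    { unfold k1. apply Rmult_le_pos; [lra|]. apply Rmult_le_pos; [lra|apply Rlt_le, Rpower_pos]. }
    apply Rle_trans with ((k1 * Rabs (v x) - k2 * Rpower (V x) (b / 2)) * cosh2 x).
    - unfold wt.
      assert (- (v x * sinh2 x) <= Rabs (v x) * cosh2 x).
      { apply Rle_trans with (Rabs (v x * sinh2 x)).
        - rewrite <- Rabs_Ropp. apply Rle_abs.
        - rewrite Rabs_mult. apply Rmult_le_compat_l; [apply Rabs_pos|apply Rabs_sinh2_le]. }
      nra.
    - apply Rmult_le_compat_r; [lra|]. apply Rle_trans with (2 := G1).
      unfold k1, k2. apply Rmult_le_compat_l with (r := cosh_weight_constant) in G2; lra. }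
  assert (HI : RInt (fun x => - k1 * (v x * sinh2 x) + - k2 * wt x) (- S) S
            <= RInt (fun x => n x * cosh2 x) (- S) S).
  { apply RInt_le; [lra| |now apply ex_RInt_cont|assumption].
    apply ex_RInt_cont. intros x.
    apply (continuous_plus (V := R_NormedModule)
        (fun x => - k1 * (v x * sinh2 x)) (fun x => - k2 * wt x)).
    - apply continuous_mult_R; [apply continuous_const|apply Cvs].
    - apply continuous_mult_R; [apply continuous_const|apply Cwt]. }
  apply Rle_trans with (2 := HI).
  rewrite (RInt_plus (V := R_CompleteNormedModule)
     (fun x => - k1 * (v x * sinh2 x)) (fun x => - k2 * wt x)).
  2: { apply ex_RInt_cont. intros x. apply continuous_mult_R; [apply continuous_const|apply Cvs]. }
  2: { apply ex_RInt_cont. intros x. apply continuous_mult_R; [apply continuous_const|apply Cwt]. }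
  rewrite (RInt_scal (V := R_CompleteNormedModule) (fun x => v x * sinh2 x)) by now apply ex_RInt_cont.
  rewrite (RInt_scal (V := R_CompleteNormedModule) wt) by now apply ex_RInt_cont.
  unfold plus, scal; simpl; unfold mult; simpl.
  assert (HWI := cosh_weight_integral S HS). fold W wt in HWI.
  replace (- k1 * RInt (fun x => v x * sinh2 x) (- S) S) with (k1 * F) by (unfold F; ring).
  assert (Hk2 : 0 <= k2).
  { unfold k2. apply Rmult_le_pos; [lra|]. apply Rmult_le_pos; [lra|apply Rlt_le, Rpower_pos]. }
  apply Rle_trans with (k1 * F + - k2 * W); [|nra].
  apply Req_le. unfold k1, k2.
  assert (HFla : F = la * W) by (unfold la; field; lra).
  assert (Elp : Rpower la p = Rpower la (p - 1) * la).
  { rewrite <- (Rpower_1 la) at 3 by assumption. rewrite <- Rpower_plus. f_equal. ring. }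
  assert (EW : Rpower F p * Rpower W (1 - p) = Rpower la p * W).
  { rewrite HFla, <- Rpower_mult_distr by assumption. rewrite Rmult_assoc, <- Rpower_plus.
    replace (p + (1 - p)) with 1 by ring. now rewrite Rpower_1. }
  rewrite EW, Elp, HFla. ring.
Qed.
End Holder.

(** * The moments of a solution *)

Definition cosh_moment (L : R) (h : R -> R -> R) (t : R) : R :=
  RInt (fun x => h x (Rabs t) * cosh2 x) (- L) L.

Lemma cont_strip_mult_cosh2 (T : R) (h : R -> R -> R) :
  cont_strip T h -> cont_strip T (fun x t => h x t * cosh2 x).
Proof.
  intros H x t Ht.
  apply (continuity_2d_pt_mult (fun y s => h y (Rabs s)) (fun y _ => cosh2 y)).
  - now apply H.
  - apply (continuity_1d_2d_pt_comp cosh2 (fun y _ => y)).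
    + apply continuity_pt_filterlim, continuous_cosh2.
    + apply continuity_2d_pt_id1.
Qed.

Lemma ex_RInt_cosh (T a b t : R) (h : R -> R -> R) :
  cont_strip T h -> 0 <= t < T -> ex_RInt (fun x => h x t * cosh2 x) a b.
Proof.
  intros H Ht. apply ex_RInt_cont. intros x.
  apply (cont_strip_x T (fun x t => h x t * cosh2 x)); [|assumption].
  now apply cont_strip_mult_cosh2.
Qed.

Lemma cosh_moment_continuity (T L : R) (h : R -> R -> R) (t : R) :
  0 < L -> cont_strip T h -> 0 <= t < T -> continuity_pt (cosh_moment L h) t.
Proof.
  intros HL H Ht e He.
  assert (HC := cont_strip_mult_cosh2 T h H).
  assert (He' : 0 < e / (4 * L)) by (apply Rdiv_lt_0_compat; lra).
  destruct (uniform_continuity_2d_1d (fun x s => h x (Rabs s) * cosh2 x) (- L) L t)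
    with (eps := mkposreal _ He') as [d Hd].
  { intros x _. apply HC. rewrite Rabs_pos_eq; lra. }
  pose proof (cond_pos d) as Hd0.
  assert (Hm : 0 < Rmin d (T - t)) by (apply Rmin_pos; lra).
  exists (Rmin d (T - t)). split; [assumption|].
  intros s [_ Hs]. simpl in Hs. unfold Rdist in Hs. simpl. unfold Rdist.
  pose proof (Rmin_l d (T - t)). pose proof (Rmin_r d (T - t)).
  assert (Hst : 0 <= Rabs s < T).
  { split; [apply Rabs_pos|]. pose proof (Rabs_triang_inv s t).
    rewrite (Rabs_pos_eq t) in H2 by lra. lra. }
  assert (Hat : 0 <= Rabs t < T) by (rewrite Rabs_pos_eq; lra).
  unfold cosh_moment.
  replace (RInt (fun x => h x (Rabs s) * cosh2 x) (- L) L
           - RInt (fun x => h x (Rabs t) * cosh2 x) (- L) L)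
    with (RInt (fun x => h x (Rabs s) * cosh2 x - h x (Rabs t) * cosh2 x) (- L) L).
  2: { apply (RInt_minus (V := R_CompleteNormedModule)
         (fun x => h x (Rabs s) * cosh2 x) (fun x => h x (Rabs t) * cosh2 x));
       now apply (ex_RInt_cosh T). }
  apply Rle_lt_trans with ((L - - L) * (e / (4 * L))).
  - apply abs_RInt_le_const; [lra| |].
    + apply (ex_RInt_minus (V := R_NormedModule)
         (fun x => h x (Rabs s) * cosh2 x) (fun x => h x (Rabs t) * cosh2 x));
       now apply (ex_RInt_cosh T).
    + intros x Hx. apply Rlt_le. apply Rabs_lt_between in Hs.
      apply (Hd x t x s); try lra. rewrite Rminus_eq_0, Rabs_R0. assumption.
  - replace ((L - - L) * (e / (4 * L))) with (e / 2) by (field; lra). lra.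
Qed.

Lemma cosh_moment_derive (T L : R) (h ht : R -> R -> R) (t : R) :
  0 < L -> cont_strip T h -> cont_strip T ht ->
  (forall x s, 0 < s < T -> is_derive (h x) s (ht x s)) ->
  0 < t < T -> is_derive (cosh_moment L h) t (cosh_moment L ht t).
Proof.
  intros HL Ch Cht Hd Ht.
  assert (HD : forall x s, 0 < s < T ->
    is_derive (fun r => h x (Rabs r) * cosh2 x) s (ht x (Rabs s) * cosh2 x)).
  { intros x s Hs.
    apply is_derive_ext_loc with (fun r => cosh2 x * h x r).
    - apply (locally_interior T); [assumption|]. intros r Hr.
      rewrite Rabs_pos_eq by lra. apply Rmult_comm.
    - evar_last; [apply (is_derive_scal (h x) s (cosh2 x)); now apply Hd|].
      rewrite Rabs_pos_eq by lra. apply Rmult_comm. }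
  unfold cosh_moment.
  replace (RInt (fun x => ht x (Rabs t) * cosh2 x) (- L) L)
    with (RInt (fun x => Derive (fun r => h x (Rabs r) * cosh2 x) t) (- L) L).
  2: { apply RInt_ext. intros x _. now apply is_derive_unique, HD. }
  apply (is_derive_RInt_param (fun s x => h x (Rabs s) * cosh2 x)).
  - apply (locally_interior T); [assumption|]. intros s Hs x _.
    eexists. now apply HD.
  - intros x _.
    apply (continuity_2d_pt_ext_loc (fun s y => ht y (Rabs s) * cosh2 y)).
    + assert (Hpos : 0 < Rmin t (T - t)) by (apply Rmin_pos; lra).
      exists (mkposreal _ Hpos). simpl. intros s y Hs _.
      pose proof (Rmin_l t (T - t)). pose proof (Rmin_r t (T - t)).
      apply Rabs_lt_between in Hs. symmetry. apply is_derive_unique, HD. lra.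
    + intros e. destruct (cont_strip_mult_cosh2 T ht Cht x t) with (eps := e) as [d Hdd].
      { rewrite Rabs_pos_eq; lra. }
      exists d. intros s y Hs Hy. now apply Hdd.
  - apply (locally_interior T); [assumption|]. intros s Hs.
    apply (ex_RInt_cosh T); [assumption|]. rewrite Rabs_pos_eq; lra.
Qed.

(** The boundary terms vanish because [L] lies outside the support of [u(.,t)] for
    every [t < T]. *)
Lemma moment_by_parts (p a r T L t : R) (u0 u1 : R -> R)
    (u ux ut uxx uxt utt : R -> R -> R) :
  1 < p -> regular_solution p a u0 u1 T u ux ut uxx uxt utt ->
  (forall x, r < Rabs x -> u0 x = 0 /\ u1 x = 0) -> 0 <= r -> T + r <= L ->
  0 <= t < T ->
  RInt (fun x => ux x t * sinh2 x) (- L) L = - RInt (fun x => u x t * cosh2 x) (- L) L /\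
  RInt (fun x => uxx x t * cosh2 x) (- L) L = RInt (fun x => u x t * cosh2 x) (- L) L.
Proof.
  intros hp hu Hdata Hr HL Ht.
  assert (Hfs := finite_speed p a T u0 u1 u ux ut uxx uxt utt hp hu r Hdata).
  destruct (Hfs (- L) t Ht) as [B1 B2]. { rewrite Rabs_left; lra. }
  destruct (Hfs L t Ht) as [B3 B4]. { rewrite Rabs_pos_eq; lra. }
  assert (E1 : RInt (fun x => ux x t * sinh2 x) (- L) L
               = - RInt (fun x => u x t * cosh2 x) (- L) L).
  { apply (RInt_by_parts (fun x => u x t) (fun x => ux x t) sinh2 cosh2); try assumption.
    - intros x. now apply hu.
    - exact is_derive_sinh2.
    - intros x. apply (cont_strip_x T); [apply hu|assumption].
    - exact continuous_cosh2. }
  split; [exact E1|].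
  assert (E2 : RInt (fun x => uxx x t * cosh2 x) (- L) L
               = - RInt (fun x => ux x t * sinh2 x) (- L) L).
  { apply (RInt_by_parts (fun x => ux x t) (fun x => uxx x t) cosh2 sinh2); try assumption.
    - intros x. now apply hu.
    - exact is_derive_cosh2.
    - intros x. apply (cont_strip_x T); [apply hu|assumption].
    - exact continuous_sinh2. }
  rewrite E2, E1. apply Ropp_involutive.
Qed.

Lemma abs_pow_0 (p : R) : abs_pow 0 p = 0.
Proof. unfold abs_pow. destruct (Req_EM_T 0 0) as [|Hn]; [reflexivity|now elim Hn]. Qed.

Definition source_constant (p a A r : R) : R :=
  cosh_weight_constant a A * Rpower 4 (1 - p) * exp ((1 - p) * r) *
  Rpower 2 (- Rabs (- a / 2)).

Lemma source_constant_pos (p a A r : R) : 0 < source_constant p a A r.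
Proof.
  unfold source_constant, cosh_weight_constant.
  repeat apply Rmult_lt_0_compat; apply Rpower_pos || apply exp_pos.
Qed.

Section Moment.
Variables (p a r A T : R) (u0 u1 : R -> R) (u ux ut uxx uxt utt : R -> R -> R).
Hypotheses (hp : 1 < p) (hr : 0 <= r) (hA : 1 <= A) (hbA : Rabs (a / (p - 1)) <= A).
Hypotheses (hT : 0 < T) (hu : regular_solution p a u0 u1 T u ux ut uxx uxt utt).
Hypothesis hdata : forall x, r < Rabs x -> u0 x = 0 /\ u1 x = 0.
Let L := T + r.

Lemma moment_source (t : R) :
  0 < t < T ->
  cosh_moment L utt t - cosh_moment L u t =
  RInt (fun x => (utt x t - uxx x t) * cosh2 x) (- (t + r)) (t + r).
Proof.
  intros Ht. unfold cosh_moment. rewrite (Rabs_pos_eq t) by lra.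
  destruct (moment_by_parts p a r T L t u0 u1 u ux ut uxx uxt utt) as [_ E];
    try assumption; try (unfold L; lra).
  rewrite <- E.
  assert (C : forall x, continuous (fun x => (utt x t - uxx x t) * cosh2 x) x).
  { intros x. apply continuous_mult_R; [|apply continuous_cosh2].
    apply (continuous_minus (V := R_NormedModule) (fun x => utt x t) (fun x => uxx x t));
      apply (cont_strip_x T); (apply hu || lra). }
  transitivity (RInt (fun x => (utt x t - uxx x t) * cosh2 x) (- L) L);
    [|apply (RInt_restrict _ (t + r) L C)].
  - symmetry. erewrite RInt_ext.
    + apply (RInt_minus (V := R_CompleteNormedModule) (fun x => utt x t * cosh2 x)
        (fun x => uxx x t * cosh2 x)); apply (ex_RInt_cosh T); (apply hu || lra).
    + intros x _. unfold minus, plus, opp; simpl. ring.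
  - unfold L. lra.
  - intros x Hx. rewrite (rs_eq _ _ _ _ _ _ _ _ _ _ _ hu) by lra.
    destruct (finite_speed p a T u0 u1 u ux ut uxx uxt utt hp hu r hdata x t) as [_ ->];
      [lra|lra|].
    rewrite abs_pow_0. unfold Rdiv. ring.
Qed.

Lemma moment_source_nonneg (t : R) :
  0 < t < T -> 0 <= cosh_moment L utt t - cosh_moment L u t.
Proof.
  intros Ht. rewrite moment_source by assumption.
  apply RInt_ge_0; [lra| |].
  - apply ex_RInt_cont. intros x. apply continuous_mult_R; [|apply continuous_cosh2].
    apply (continuous_minus (V := R_NormedModule) (fun x => utt x t) (fun x => uxx x t));
      apply (cont_strip_x T); (apply hu || lra).
  - intros x _. rewrite (rs_eq _ _ _ _ _ _ _ _ _ _ _ hu) by lra.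
    apply Rmult_le_pos; [|apply Rlt_le, cosh2_pos].
    apply Rdiv_le_0_compat; [apply abs_pow_nonneg|apply Rpower_pos].
Qed.

(** The exponentials balance exactly: with [F = e^t H] and [W] of order [e^t] the
    power of [e^t] is [-1 + p + (1-p) = 0]. *)
Lemma moment_source_lower (t : R) :
  0 < t < T -> 0 < cosh_moment L u t ->
  source_constant p a A r * Rpower (exp (- t) * cosh_moment L u t) p
    * Rpower (t + (r + A)) (- a)
  <= exp (- t) * (cosh_moment L utt t - cosh_moment L u t).
Proof.
  intros Ht HF. rewrite moment_source by assumption.
  set (F := cosh_moment L u t) in *. set (S := t + r).
  set (b := a / (p - 1)) in *.
  assert (HFS : F = - RInt (fun x => ux x t * sinh2 x) (- S) S).
  { rewrite <- (RInt_restrict (fun x => ux x t * sinh2 x) S L).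
    - destruct (moment_by_parts p a r T L t u0 u1 u ux ut uxx uxt utt) as [E _];
        try assumption; try (unfold L; lra).
      rewrite E. unfold F, cosh_moment. rewrite (Rabs_pos_eq t) by lra.
      symmetry. apply Ropp_involutive.
    - intros x. apply continuous_mult_R; [|apply continuous_sinh2].
      apply (cont_strip_x T); [apply hu|lra].
    - unfold S, L. lra.
    - intros x Hx.
      destruct (finite_speed p a T u0 u1 u ux ut uxx uxt utt hp hu r hdata x t) as [_ ->];
        [lra|unfold S in Hx; lra|ring]. }
  assert (HS : 0 <= S) by (unfold S; lra).
  assert (HH := holder_cosh p a A hp hA hbA S (fun x => ux x t) (fun x => utt x t - uxx x t) HS).
  cbv zeta beta in HH. rewrite <- HFS in HH.
  apply Rle_trans with (exp (- t) *
    (cosh_weight_constant a A * (Rpower F p *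
      Rpower (4 * (exp S * Rpower (S ^ 2 + A ^ 2) (b / 2))) (1 - p)))).
  2: { apply Rmult_le_compat_l; [apply Rlt_le, exp_pos|]. apply HH; try assumption.
       - intros x. apply (cont_strip_x T); [apply hu|lra].
       - intros x. apply (continuous_minus (V := R_NormedModule) (fun x => utt x t) (fun x => uxx x t));
           apply (cont_strip_x T); (apply hu || lra).
       - intros x _. rewrite (rs_eq _ _ _ _ _ _ _ _ _ _ _ hu) by lra. apply Rle_refl. }
  clear HH.
  assert (HV : 0 < S ^ 2 + A ^ 2) by (pose proof (pow2_ge_0 S); nra).
  assert (Hcmp : Rpower 2 (- Rabs (- a / 2)) * Rpower (t + (r + A)) (- a)
             <= Rpower (S ^ 2 + A ^ 2) (- a / 2)).
  { replace (Rpower (t + (r + A)) (- a)) with (Rpower ((S + A) ^ 2) (- a / 2)).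
    - assert (0 <= S * A) by (apply Rmult_le_pos; lra).
      pose proof (pow2_ge_0 (S - A)).
      apply Rpower_comparable; try lra; try nra.
    - rewrite <- Rpower_pow, Rpower_mult by lra.
      f_equal; [unfold S; ring|simpl; field]. }
  rewrite <- (Rpower_mult_distr (exp (- t)) F) by (apply exp_pos || assumption).
  assert (HeS : forall x y, Rpower (exp x) y = exp (y * x)).
  { intros x y. unfold Rpower. now rewrite ln_exp. }
  rewrite <- (Rpower_mult_distr 4) by
    first [lra | apply Rmult_lt_0_compat; [apply exp_pos|apply Rpower_pos]].
  rewrite <- (Rpower_mult_distr (exp S)) by (apply exp_pos || apply Rpower_pos).
  rewrite Rpower_mult, !HeS.
  replace (b / 2 * (1 - p)) with (- a / 2) by (unfold b; field; lra).
  unfold source_constant.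
  replace (exp ((1 - p) * S)) with (exp ((1 - p) * r) * exp ((1 - p) * t)).
  2: { rewrite <- exp_plus. f_equal. unfold S. ring. }
  assert (Eexp : exp (p * - t) = exp (- t) * exp ((1 - p) * t)).
  { rewrite <- exp_plus. f_equal. ring. }
  rewrite Eexp.
  set (X := cosh_weight_constant a A * Rpower 4 (1 - p) * exp ((1 - p) * r)
            * exp (- t) * exp ((1 - p) * t) * Rpower F p).
  assert (HX : 0 <= X).
  { unfold X, cosh_weight_constant.
    apply Rlt_le. repeat apply Rmult_lt_0_compat; apply Rpower_pos || apply exp_pos. }
  apply Rmult_le_compat_l with (r := X) in Hcmp; [|assumption].
  unfold X in Hcmp.
  match type of Hcmp with ?l <= ?m => match goal with |- ?l' <= ?m' =>
    replace l' with l by ring; replace m' with m by ring end end.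
  exact Hcmp.
Qed.
End Moment.

Lemma moments_satisfy_ode (T L : R) (u ut utt : R -> R -> R) :
  0 < L -> cont_strip T u -> cont_strip T ut -> cont_strip T utt ->
  (forall x t, 0 < t < T -> is_derive (u x) t (ut x t)) ->
  (forall x t, 0 < t < T -> is_derive (ut x) t (utt x t)) ->
  let H := fun t => exp (- t) * cosh_moment L u t in
  let K := fun t => exp (- t) * (cosh_moment L ut t - cosh_moment L u t) in
  let K1 := fun t => exp (- t) * (cosh_moment L utt t - cosh_moment L u t) - 2 * K t in
  (forall t, 0 <= t < T -> continuity_pt H t) /\
  (forall t, 0 <= t < T -> continuity_pt K t) /\
  (forall t, 0 < t < T -> is_derive H t (K t)) /\
  (forall t, 0 < t < T -> is_derive K t (K1 t)).
Proof.
  intros HL Cu Cut Cutt Du Dut H K K1.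
  assert (De : forall t, is_derive (fun s => exp (- s)) t (- exp (- t))).
  { intros t. auto_derive; [exact I|ring]. }
  assert (Ce : forall t, continuity_pt (fun s => exp (- s)) t).
  { intros t. eapply is_derive_continuity_pt, De. }
  assert (Cm : forall h, cont_strip T h -> forall t, 0 <= t < T -> continuity_pt (cosh_moment L h) t).
  { intros h Ch t Ht. now apply (cosh_moment_continuity T). }
  split; [|split; [|split]]; intros t Ht.
  - apply (continuity_pt_mult (fun s => exp (- s)) (cosh_moment L u)); auto.
  - apply (continuity_pt_mult (fun s => exp (- s))
      (fun s => cosh_moment L ut s - cosh_moment L u s)); auto.
    apply (continuity_pt_minus (cosh_moment L ut) (cosh_moment L u)); auto.
  - evar_last.
    + apply (is_derive_mult (fun s => exp (- s)) (cosh_moment L u)).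
      * apply De.
      * apply (cosh_moment_derive T L u ut); assumption.
      * intros; apply Rmult_comm.
    + unfold K, plus, mult; simpl. ring.
  - evar_last.
    + apply (is_derive_mult (fun s => exp (- s)) (fun s => cosh_moment L ut s - cosh_moment L u s)).
      * apply De.
      * apply (is_derive_minus (cosh_moment L ut) (cosh_moment L u)).
        -- apply (cosh_moment_derive T L ut utt); assumption.
        -- apply (cosh_moment_derive T L u ut); assumption.
      * intros; apply Rmult_comm.
    + unfold K1, K, plus, mult, minus, plus, opp; simpl. ring.
Qed.

(** * The initial data and the conclusion *)

Lemma supp_zero (f : R -> R) (r x : R) :
  included (supp f) (fun x => Rabs x <= r) -> r < Rabs x -> f x = 0.
Proof.
  intros H Hx. destruct (Req_dec (f x) 0) as [|Hn]; [assumption|exfalso].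
  assert (Hs : Rabs x <= r); [|lra].
  apply H. intros V [d Hd]. exists x. split; [|assumption].
  apply Hd. unfold disc. rewrite Rminus_eq_0, Rabs_R0. apply cond_pos.
Qed.

(** One integration by parts turns the hypotheses on [f] and [g - f] into the
    signs of their [cosh2] moments. *)
Lemma data_integral (h dh : R -> R) (r : R) :
  0 <= r -> (forall x, is_derive h x (dh x)) -> (forall x, continuous dh x) ->
  (forall x, r < Rabs x -> h x = 0) ->
  integral_R (fun x => (- exp x + exp (- x)) * dh x)
  = RInt (fun x => h x * cosh2 x) (- r) r.
Proof.
  intros Hr D C Hz.
  assert (Cs : forall x, continuous (fun x => (- exp x + exp (- x)) * dh x) x).
  { intros x. apply continuous_mult_R; [|apply C].
    eapply is_derive_continuous. auto_derive; [exact I|reflexivity]. }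
  rewrite (integral_R_supported _ r (r + 1)); [|assumption|lra|].
  2: { intros x Hx. rewrite (derive_zero_outside h r x (dh x) Hz Hx (D x)). ring. }
  assert (Csd : forall x, continuous (fun x => dh x * sinh2 x) x).
  { intros x. apply continuous_mult_R; [apply C|apply continuous_sinh2]. }
  rewrite (RInt_ext _ (fun x => opp (dh x * sinh2 x))).
  2: { intros x _. unfold sinh2, opp; simpl. ring. }
  rewrite (RInt_opp (V := R_CompleteNormedModule)) by now apply ex_RInt_cont.
  rewrite (RInt_by_parts h dh sinh2 cosh2); try assumption.
  - unfold opp; simpl. rewrite Ropp_involutive. apply RInt_restrict; [|lra|].
    + intros x. apply continuous_mult_R; [|apply continuous_cosh2].
      eapply is_derive_continuous, D.
    + intros x Hx. rewrite Hz by assumption. ring.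
  - exact is_derive_sinh2.
  - exact continuous_cosh2.
  - apply Hz. rewrite Rabs_left; lra.
  - apply Hz. rewrite Rabs_pos_eq; lra.
Qed.

Lemma cosh_moment_initial (r L eps : R) (h : R -> R -> R) (h0 : R -> R) :
  0 <= r <= L -> (forall x, continuous h0 x) ->
  (forall x, r < Rabs x -> h0 x = 0) -> (forall x, h x 0 = eps * h0 x) ->
  cosh_moment L h 0 = eps * RInt (fun x => h0 x * cosh2 x) (- r) r.
Proof.
  intros Hr C Hz Hh. unfold cosh_moment. rewrite Rabs_R0.
  assert (C' : forall x, continuous (fun x => h0 x * cosh2 x) x).
  { intros x. apply continuous_mult_R; [apply C|apply continuous_cosh2]. }
  rewrite <- (RInt_restrict (fun x => h0 x * cosh2 x) r L); try assumption.
  2: { intros x Hx. rewrite Hz by assumption. ring. }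
  rewrite (RInt_ext _ (fun x => scal eps (h0 x * cosh2 x))).
  - rewrite (RInt_scal (V := R_CompleteNormedModule)) by now apply ex_RInt_cont. reflexivity.
  - intros x _. rewrite Hh. unfold scal; simpl; unfold mult; simpl. ring.
Qed.

Theorem theorem2p2 (p a r : R) (f g : R -> R)
  (hp : 1 < p) (ha : a <= 1) (hr : 1 <= r)
  (hf : Ck0 2 f) (hg : Ck0 1 g)
  (hsf : included (supp f) (fun x => Rabs x <= r))
  (hsg : included (supp g) (fun x => Rabs x <= r))
  (hif : integral_R (fun x => (- exp x + exp (- x)) * Derive f x) >= 0)
  (hig : integral_R
           (fun x => (- exp x + exp (- x)) * (Derive g x - Derive f x)) > 0) :
  exists eps1 C : R, 0 < eps1 /\ 0 < C /\
    forall eps : R, 0 < eps <= eps1 ->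
    forall T : R, T > lifespan_bound p a C eps ->
      ~ exists u : R -> R -> R,
          classical_solution p a (fun x => eps * f x) (fun x => eps * g x) T u.
Proof.
  assert (C1 : forall k h, (1 <= k)%nat -> Ck0 k h ->
    (forall x, ex_derive h x) /\ (forall x, continuous (Derive h) x)).
  { intros k h Hk [Hh _]. split; intros x; apply (Hh 1%nat x Hk). }
  destruct (C1 2%nat f ltac:(auto) hf) as [Df Cdf].
  destruct (C1 1%nat g ltac:(auto) hg) as [Dg Cdg].
  clear C1 hf hg.
  assert (Zf : forall x, r < Rabs x -> f x = 0) by (intros x; now apply supp_zero).
  assert (Zg : forall x, r < Rabs x -> g x = 0) by (intros x; now apply supp_zero).
  assert (Cf : forall x, continuous f x)
    by (intros x; now apply (ex_derive_continuous (V := R_NormedModule))).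
  assert (Cg : forall x, continuous g x)
    by (intros x; now apply (ex_derive_continuous (V := R_NormedModule))).
  rewrite (data_integral f (Derive f) r) in hif; try assumption;
    [|lra|intros x; now apply Derive_correct].
  set (c1 := RInt (fun x => f x * cosh2 x) (- r) r) in *.
  set (cg := RInt (fun x => g x * cosh2 x) (- r) r).
  assert (Hc0 : 0 < cg - c1).
  { replace (cg - c1) with (RInt (fun x => (g x - f x) * cosh2 x) (- r) r).
    - rewrite <- (data_integral (fun x => g x - f x) (fun x => Derive g x - Derive f x) r).
      + exact hig.
      + lra.
      + intros x. apply (is_derive_minus g f); now apply Derive_correct.
      + intros x. now apply (continuous_minus (V := R_NormedModule) (Derive g) (Derive f)).
      + intros x Hx. rewrite Zf, Zg by assumption. ring.
    - erewrite RInt_ext.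
      + apply (RInt_minus (V := R_CompleteNormedModule) (fun x => g x * cosh2 x)
          (fun x => f x * cosh2 x)); apply ex_RInt_cont; intros x;
          apply continuous_mult_R; (apply continuous_cosh2 || auto).
      + intros x _. unfold minus, plus, opp; simpl. ring. }
  set (A := 1 + Rabs (a / (p - 1))).
  pose proof (Rabs_pos (a / (p - 1))) as HbA.
  destruct (ode_blow_up p a (r + A) (source_constant p a A r) (cg - c1) c1)
    as [eps1 [C [He1 [HC Hblow]]]]; try assumption; try (unfold A; lra).
  { apply source_constant_pos. }
  exists eps1, C. split; [assumption|]. split; [assumption|].
  intros eps Heps T HT [u hu].
  assert (hT : 0 < T).
  { apply Rlt_trans with (2 := HT). unfold lifespan_bound.
    destruct (Rlt_dec a 1); [|apply exp_pos].
    apply Rmult_lt_0_compat; [assumption|apply Rpower_pos]. }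
  destruct (classical_regular _ _ _ _ _ _ hT hu) as [ux [ut [uxx [uxt [utt hreg]]]]].
  assert (hdata : forall x, r < Rabs x -> eps * f x = 0 /\ eps * g x = 0).
  { intros x Hx. rewrite Zf, Zg by assumption. lra. }
  set (L := T + r).
  destruct (moments_satisfy_ode T L u ut utt) as [CH [CK [DH DK]]]; try apply hreg.
  { unfold L. lra. }
  refine (Hblow eps Heps T HT _ _ _ CH CK DH DK _ _ _ _).
  - rewrite Ropp_0, exp_0, Rmult_1_l.
    apply cosh_moment_initial; try assumption; [unfold L; lra|]. apply hreg.
  - rewrite Ropp_0, exp_0, Rmult_1_l.
    rewrite (cosh_moment_initial r L eps u f), (cosh_moment_initial r L eps ut g);
      try assumption; try (unfold L; lra); try apply hreg.
    fold cg c1. ring.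
  - intros t Ht.
    match goal with |- 0 <= ?X => replace X with
      (exp (- t) * (cosh_moment L utt t - cosh_moment L u t)) by ring end.
    apply Rmult_le_pos; [apply Rlt_le, exp_pos|].
    apply (moment_source_nonneg p a r T (fun x => eps * f x) (fun x => eps * g x)
       u ux ut uxx uxt utt); try assumption. lra.
  - intros t Ht HHt.
    match goal with |- _ <= ?X => replace X with
      (exp (- t) * (cosh_moment L utt t - cosh_moment L u t)) by ring end.
    apply (moment_source_lower p a r A T (fun x => eps * f x) (fun x => eps * g x)
       u ux ut uxx uxt utt); try assumption; try (unfold A; lra).
    pose proof (exp_pos (- t)).
    apply Rmult_lt_reg_l with (exp (- t)); [assumption|]. rewrite Rmult_0_r. exact HHt.
Qed.
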